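(* Let $T>0$, let $n,m\ge 1$ be integers, and let $B_{i,j}:[0,T]\to M_n(\mathbb{C})$ for $1\le i\le j\le m$. Let $C_{i,j}:[0,T]\to M_n(\mathbb{C})$, $1\le i\le j\le m$, be defined implicitly by $$\begin{pmatrix} C_{1,1}(t) & C_{1,2}(t) & \cdots & C_{1,m}(t)\\ 0 & C_{2,2}(t) & \cdots & C_{2,m}(t)\\ \vdots & \ddots & \ddots & \vdots\\ 0&0&\cdots& C_{m,m}(t)\end{pmatrix}=\mathcal{T}\exp\left[\int_0^t dt_1\begin{pmatrix} B_{1,1}(t_1) & B_{1,2}(t_1) & \cdots & B_{1,m}(t_1)\\ 0 & B_{2,2}(t_1) & \cdots & B_{2,m}(t_1)\\ \vdots & \ddots & \ddots & \vdots\\ 0&0&\cdots& B_{m,m}(t_1)\end{pmatrix}\right],$$ and assume that the $B_{i,j}$ are such that the solution to the initial value problem associated with this time-ordered exponential exists and is unique. For $1\le i\le m$ put $U_i(t)=\mathcal{T}\exp\left(\int_0^t dt_1\,B_{i,i}(t_1)\right)$. For $q\ge 2$ and indices $i_1<\dots<i_q$ in $\{1,\dots,m\}$ put $$\mathrm{Int}_{(i_1,\dots,i_q)}(t)=U_{i_1}(t)\int_0^t dt_1\cdots\int_0^{t_{q-2}}dt_{q-1}\;U_{i_1}^{-1}(t_1)B_{i_1,i_2}(t_1)U_{i_2}(t_1)\cdots U_{i_{q-1}}^{-1}(t_{q-1})B_{i_{q-1},i_q}(t_{q-1})U_{i_q}(t_{q-1}).$$ Then for all $1\le s\le m$, all $1\le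 j\le m-s$, and all $t\in[0,T]$: $$C_{s,s}(t)=U_s(t)$$ (this first identity holding for every $1\le s\le m$), and $$C_{s,s+j}(t)=\mathrm{Int}_{(s,s+j)}(t)+\sum_{r=1}^{j-1}\;\sum_{s<i_1<\dots<i_r<s+j}\mathrm{Int}_{(s,i_1,\dots,i_r,s+j)}(t),$$ where the inner sum is over all integer tuples $(i_1,\dots,i_r)$ satisfying the displayed inequalities. Alternatively, these matrices are given recursively by $$C_{s,s+j}(t)=\sum_{i=1}^{j}U_s(t)\int_0^t dt_1\,U_s^{-1}(t_1)B_{s,s+i}(t_1)C_{s+i,s+j}(t_1).$$
   Context: $M_n(\mathbb{C})$ is the set of $n\times n$ complex matrices and $\mathbb{1}_N$ is the $N\times N$ identity matrix. For a matrix-valued function $G:[0,T]\to M_N(\mathbb{C})$, the time-ordered exponential $\mathcal{T}\exp\left(\int_0^t dt_1\,G(t_1)\right)$ is notation for the value at $t$ of the unique solution $U$ of the initial value problem $\dot U(t)=G(t)U(t)$, $U(0)=\mathbb{1}_N$ on $[0,T]$. The block matrix in the claim is regarded as an $mn\times mn$ matrix, so the corresponding initial value problem is of this form with $N=mn$. Explicit regularity conditions on the $B_{i,j}$ are not stated; the standing understanding is that they are regular enough for the existence and uniqueness assumption to hold and for the integrals to make sense, piecewise continuity on $[0,T]$ being sufficient. *)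

(* Defs.v *)
From HB Require Import structures.
From mathcomp Require Import all_boot all_order all_algebra.
From mathcomp Require Import all_classical all_reals all_analysis.
From mathcomp Require Import complex.
Import Order.TTheory GRing.Theory Num.Theory.
Import numFieldNormedType.Exports.

Set Implicit Arguments.
Unset Strict Implicit.
Unset Printing Implicit Defensive.

Local Open Scope classical_set_scope.
Local Open Scope ring_scope.

(* Functions on [0, T] are represented by functions on R of which only the
   values on [0, T] matter.  Real and imaginary parts are taken entrywise
   because the library has no topology or integral for R[i] as a real space. *)

Definition mx_continuous_on (R : realType) (T : R) (N : nat)
    (U : R -> 'M[R[i]]_N) : Prop :=
  forall k l : 'I_N,
    {within `[0, T], continuous (fun x : R => complex.Re (U x k l))} /\
    {within `[0, T], continuous (fun x : R => complex.Im (U x k l))}.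

Definition mx_is_derive (R : realType) (N : nat)
    (t : R) (U : R -> 'M[R[i]]_N) (D : 'M[R[i]]_N) : Prop :=
  forall k l : 'I_N,
    is_derive t (1 : R) (fun x : R => complex.Re (U x k l))
      (complex.Re (D k l)) /\
    is_derive t (1 : R) (fun x : R => complex.Im (U x k l))
      (complex.Im (D k l)).

Definition mx_integrable_on (R : realType) (T : R) (N : nat)
    (F : R -> 'M[R[i]]_N) : Prop :=
  forall k l : 'I_N,
    lebesgue_measure.-integrable `[0, T]
      (fun x : R => (complex.Re (F x k l))%:E) /\
    lebesgue_measure.-integrable `[0, T]
      (fun x : R => (complex.Im (F x k l))%:E).

Definition mx_int (R : realType) (N : nat)
    (F : R -> 'M[R[i]]_N) (t : R) : 'M[R[i]]_N :=
  \matrix_(k < N, l < N)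
    (Rintegral lebesgue_measure `[0, t] (fun x : R => complex.Re (F x k l)) +i*
     Rintegral lebesgue_measure `[0, t] (fun x : R => complex.Im (F x k l)))%C.

(* The differential equation may fail at finitely many points, such as the
   discontinuities of a piecewise continuous G (and the end points). *)
Definition is_ivp_solution (R : realType) (T : R) (N : nat)
    (G U : R -> 'M[R[i]]_N) : Prop :=
  [/\ mx_continuous_on T U,
      U 0 = 1%:M
    & exists S : seq R, forall t : R, t \in `]0, T[ -> t \notin S ->
        mx_is_derive t U (G t *m U t)].

Definition is_unique_ivp_solution (R : realType) (T : R) (N : nat)
    (G U : R -> 'M[R[i]]_N) : Prop :=
  is_ivp_solution T G U /\
  forall V : R -> 'M[R[i]]_N, is_ivp_solution T G V ->
    forall t : R, t \in `[0, T] -> V t = U t.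

(* The default value 0 is never a solution when N > 0. *)
Definition texp (R : realType) (T : R) (N : nat)
    (G : R -> 'M[R[i]]_N) : R -> 'M[R[i]]_N :=
  xget (fun _ : R => 0) [set U | is_unique_ivp_solution T G U].

(* The blocks B i j with j < i are not used. *)
Definition upper_block (R : realType) (n m : nat)
    (B : 'I_m -> 'I_m -> R -> 'M[R[i]]_n) (t : R) :
    'M[R[i]]_(\sum_(i < m) n) :=
  \mxblock_(i < m, j < m) (if (i <= j)%N then B i j t else 0).

Definition texp_block (R : realType) (T : R) (n m : nat)
    (B : 'I_m -> 'I_m -> R -> 'M[R[i]]_n) (i j : 'I_m) (t : R) : 'M[R[i]]_n :=
  @submxblock R[i] m m (fun _ => n) (fun _ => n)
    (texp T (upper_block B) t) i j.

(* iter_int [:: A_1; ...; A_p] P t is the integral over t_1 in [0, t],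
   t_2 in [0, t_1], ..., t_p in [0, t_(p-1)] of
   P A_1(t_1) A_2(t_2) ... A_p(t_p). *)
Fixpoint iter_int (R : realType) (n : nat) (As : seq (R -> 'M[R[i]]_n))
    (P : 'M[R[i]]_n) (t : R) : 'M[R[i]]_n :=
  if As is A :: As' then mx_int (fun u : R => iter_int As' (P *m A u) u) t
  else P.

(* Int_(i_1, ..., i_q), with i1 the first index and s = [:: i_2; ...; i_q]. *)
Definition IntB (R : realType) (T : R) (n m : nat)
    (B : 'I_m -> 'I_m -> R -> 'M[R[i]]_n) (i1 : 'I_m) (s : seq 'I_m) (t : R) :
    'M[R[i]]_n :=
  texp T (B i1 i1) t *m
  iter_int
    (pairmap (fun (i j : 'I_m) (u : R) =>
       invmx (texp T (B i i) u) *m B i j u *m texp T (B j j) u) i1 s)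
    1%:M t.

(* Main.v *)
Require Import Defs.
From HB Require Import structures.
From mathcomp Require Import all_boot all_order all_algebra.
From mathcomp Require Import all_classical all_reals all_analysis.
From mathcomp Require Import measurable_realfun complex.
From mathcomp Require Import ring lra.
Import Order.TTheory GRing.Theory Num.Theory.
Import numFieldNormedType.Exports.
Local Open Scope classical_set_scope.
Local Open Scope ring_scope.

Set Implicit Arguments.
Unset Strict Implicit.
Unset Printing Implicit Defensive.

(** Writing X for the solution of the block problem, comparing blocks of
    X' = G X gives C_ij' = sum_(l >= i) B_il C_lj. Uniqueness for linear
    equations, applied from the last row upwards, kills the blocks below the
    diagonal and then identifies C_ss with U_s. Since (U_s^-1)' = - U_s^-1 B_ss,
    the derivative of U_s^-1 C_sk is sum_(s < l <= k) U_s^-1 B_sl C_lk, and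
    integrating it gives the recursion; unfolding the recursion gives the sum
    over all paths from s to k.

    The B_ij are only Lebesgue integrable, while the differential equation holds
    off a finite set, so uniqueness and the integration step both rest on the
    theorem that a continuous function, differentiable off a finite set with
    integrable derivative, is the integral of this derivative. As in Rudin's
    Real and Complex Analysis, it is obtained by majorizing the derivative by a
    lower semicontinuous function whose integral is almost the same. *)

(** * The fundamental theorem of calculus for integrable derivatives *)

(** If the point found for the tail happens to be the new element, a second search strictly below it
    succeeds. This will supply a level that avoids the values taken at finitely many exceptional
    points. *)
Lemma ex_notin_itvoo (R : realFieldType) (L : seq R) (c d : R) :
  c < d -> exists y, [/\ c < y, y < d & y \notin L].
Proof.
elim: L d => [|l L IH] d cd; first by exists ((c + d) / 2); split; [lra|lra|].
have [y [cy yd yL]] := IH d cd.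
have [yl|yl] := eqVneq y l; last first.
  by exists y; split => //; rewrite in_cons negb_or yl.
have [z [cz zy zL]] := IH y cy; exists z; split => //; first exact: lt_trans yd.
by rewrite in_cons negb_or zL andbT lt_eqF// -yl.
Qed.

Lemma within_itv_ball (R : realType) (a b : R) (f : R -> R) (x e : R) :
  {within `[a, b], continuous f} -> a <= x <= b -> 0 < e ->
  exists2 d, 0 < d & forall t, a <= t <= b -> `|t - x| < d -> `|f t - f x| < e.
Proof.
move=> cf xab e0.
move: cf => /subspace_continuousP/(_ x).
rewrite /= in_itv/= xab => /(_ isT)/cvgrPdist_lt/(_ e e0)[d /= d0 H].
exists d => // t tab tx; rewrite distrC; apply: H => //=; by rewrite distrC.
Qed.

Lemma is_derive_ball (R : realType) (f : R -> R) (x l e : R) :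
  is_derive x 1 f l -> 0 < e ->
  exists2 d, 0 < d & forall t, `|t - x| < d ->
    `|f t - f x - l * (t - x)| <= e * `|t - x|.
Proof.
move=> [+ fl] e0; rewrite /derivable.
rewrite -[lim _]/('D_1 f x) fl => /cvgrPdist_le/(_ e e0).
rewrite /= => -[d /= d0 H]; exists d => // t tx.
have [->|tnx] := eqVneq t x; first by rewrite !subrr mulr0 subr0 normr0 mulr0.
have tx0 : t - x != 0 by rewrite subr_eq0.
have := H (t - x); rewrite /= sub0r normrN => /(_ tx tx0).
rewrite scaler1 subrK => h.
rewrite -ler_pdivrMr ?normr_gt0// -normrV ?unitfE// -normrM.
by rewrite mulrBl mulfK// distrC mulrC.
Qed.

(** Suppose that F = Phi - f drops from a to b. Take a level y strictly between F b and F a and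
    outside F(S), and let x be the supremum of the points where F is at least y. Then F x = y, so x
    is interior and not in S, and the hypothesis at x gives points to its right where F is still at
    least y, a contradiction. [Phi] may jump, but being monotone it makes F jump only upwards. *)
Lemma le_increment_of_right (R : realType) (a b : R) (f Phi : R -> R)
    (S : seq R) :
  a <= b -> {within `[a, b], continuous f} ->
  {in `[a, b] &, {homo Phi : x y / x <= y}} ->
  (forall x, a < x < b -> x \notin S ->
    \forall t \near x^'+, f t - f x <= Phi t - Phi x) ->
  f b - f a <= Phi b - Phi a.
Proof.
move=> ab cf ndPhi Hr; rewrite leNgt; apply/negP => lt_ba.
pose F x := Phi x - f x.
have FF : F b < F a by rewrite /F; lra.
have [y [Fby yFa yS]] := ex_notin_itvoo (map F S) FF.
pose A := [set t | a <= t <= b /\ y <= F t].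
have Aa : A a by split; [rewrite lexx ab|exact: ltW].
have ubA : ubound A b by move=> t [/andP[]].
have hsA : has_sup A by split; [exists a|exists b].
pose x := sup A.
have ax : a <= x by apply: ub_le_sup => //; exists b.
have xb : x <= b by apply: ge_sup => //; exists a.
have xab : a <= x <= b by rewrite ax xb.
(* Approaching x from the left, f is continuous and [Phi t <= Phi x], so F x cannot fall below y. *)
have Fx_ge : y <= F x.
  rewrite leNgt; apply/negP => Fxy.
  have e0 : 0 < y - F x by lra.
  have [d d0 cfx] := within_itv_ball cf xab e0.
  have [t At xt] := sup_adherent d0 hsA.
  have tx : t <= x by apply: ub_le_sup => //; exists b.
  case: At => tab yt.
  have := cfx t tab; rewrite ler0_norm ?subr_le0//.
  move=> /(_ ltac:(rewrite -/x in xt; lra)).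
  have := ndPhi t x; rewrite !in_itv/= => /(_ tab xab tx).
  rewrite ltr_norml /F in yt * => h /andP[h1 h2].
  by rewrite /F in yt e0 Fxy; lra.
have xltb : x < b.
  by rewrite lt_neqAle xb andbT; apply/eqP => xeb;
    move: Fx_ge; rewrite xeb; lra.
have right_lt t : x < t -> t <= b -> F t < y.
  move=> xt tb; rewrite ltNge; apply/negP => yF.
  have : t <= x; last by lra.
  by apply: ub_le_sup; [exists b|split => //; rewrite tb andbT; lra].
(* To the right of x the same argument uses [Phi x <= Phi t]: F x above y would keep F above y just
   after x. *)
have Fx_le : F x <= y.
  rewrite leNgt; apply/negP => Fxy.
  have e0 : 0 < F x - y by lra.
  have [d d0 cfx] := within_itv_ball cf xab e0.
  pose t := Num.min b (x + d / 2).
  have tb : t <= b by rewrite /t ge_min lexx.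
  have xt : x < t by rewrite /t lt_min xltb/=; lra.
  have td : t <= x + d / 2 by rewrite /t ge_min lexx orbT.
  have tab : a <= t <= b by rewrite tb andbT; lra.
  have := cfx t tab; rewrite gtr0_norm ?subr_gt0// => /(_ ltac:(lra)).
  have := ndPhi x t; rewrite !in_itv/= => /(_ xab tab (ltW xt)).
  have := right_lt t xt tb.
  by rewrite ltr_norml /F => h h' /andP[h1 h2]; rewrite /F in Fxy e0; lra.
have Fxy : F x = y by apply/eqP; rewrite eq_le Fx_le Fx_ge.
have altx : a < x.
  by rewrite lt_neqAle ax andbT; apply/eqP => aex; move: Fxy; rewrite -aex; lra.
have xS : x \notin S.
  by apply/negP => xS; move/negP: yS; apply; rewrite -Fxy; exact: map_f.
have near_r := Hr x ltac:(by rewrite altx xltb) xS.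
have : \forall t \near x^'+, False; last by move=> /filter_ex[].
near=> t.
have : F t < y.
  by apply: right_lt; near: t; [exact: nbhs_right_gt|exact: nbhs_right_le].
have : f t - f x <= Phi t - Phi x by near: t.
by rewrite -Fxy /F; lra.
Unshelve. all: by end_near. Qed.

(** * Lebesgue integrals of real functions over intervals *)

Definition rintegrable (R : realType) (D : interval R) (f : R -> R) : Prop :=
  lebesgue_measure.-integrable [set` D] (fun x => (f x)%:E).

Definition rint (R : realType) (D : interval R) (f : R -> R) : R :=
  Rintegral lebesgue_measure [set` D] f.

Section rintegrable_theory.
Context {R : realType}.
Implicit Types (D E : interval R) (f g : R -> R).

Let mitv D : measurable ([set` D] : set (measurableTypeR R)).
Proof. exact: measurable_itv. Qed.

Lemma rintegrableD D f g :
  rintegrable D f -> rintegrable D g -> rintegrable D (fun x => f x + g x).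
Proof. by move=> fi gi; exact: (integrableD (mitv _) fi gi). Qed.

Lemma rintegrableZ D (r : R) f :
  rintegrable D f -> rintegrable D (fun x => r * f x).
Proof. by move=> fi; exact: (integrableZl (mitv _) r fi). Qed.

Lemma rintegrableN D f : rintegrable D f -> rintegrable D (fun x => - f x).
Proof.
by move=> /(rintegrableZ (-1)); under eq_fun do rewrite mulN1r.
Qed.

Lemma rintegrableB D f g :
  rintegrable D f -> rintegrable D g -> rintegrable D (fun x => f x - g x).
Proof. by move=> fi gi; apply: rintegrableD => //; exact: rintegrableN. Qed.

Lemma rintegrable0 D : rintegrable D (fun=> 0).
Proof. exact: integrable0. Qed.

Lemma eq_rintegrable D f g :
  {in D, f =1 g} -> rintegrable D f -> rintegrable D g.
Proof.
move=> fg; apply: (eq_integrable (mitv D)) => x /set_mem/= xD.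
by rewrite fg.
Qed.

Lemma rintegrable_sum D (I : Type) (r : seq I) (P : pred I) (F : I -> R -> R) :
  (forall i, P i -> rintegrable D (F i)) ->
  rintegrable D (fun x => \sum_(i <- r | P i) F i x).
Proof.
move=> Fi; elim: r => [|i r IH].
  by under eq_fun do rewrite big_nil; exact: rintegrable0.
under eq_fun do rewrite big_cons.
by case Pi : (P i) => //; apply: rintegrableD => //; exact: Fi.
Qed.

Lemma rintegrableS D E f :
  {subset D <= E} -> rintegrable E f -> rintegrable D f.
Proof. by move=> DE; apply: integrableS => // x /=; exact: DE. Qed.

Lemma lebesgue_measure_itv_lty (a b : R) (A : set R) :
  A `<=` `[a, b] -> measurable A -> (lebesgue_measure A < +oo)%E.
Proof.
move=> AB mA; apply: (@le_lt_trans _ _ (lebesgue_measure `[a, b])).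
  by apply: le_measure => //; rewrite inE//; exact: measurable_itv.
by rewrite lebesgue_measure_itv/=; case: ifP => // _; rewrite -EFinD ltry.
Qed.

Lemma bounded_rintegrable (a b M : R) f : measurable_fun `[a, b] f ->
  (forall x, x \in `[a, b] -> `|f x| <= M) -> rintegrable `[a, b] f.
Proof.
move=> mf fM; apply: (measurable_bounded_integrable (mitv `[a, b])) => //.
  exact: (@lebesgue_measure_itv_lty a b).
exists M; split; first exact: num_real.
by move=> N MN x Dx /=; rewrite (le_trans (fM x Dx))// ltW.
Qed.

Lemma rintD D f g : rintegrable D f -> rintegrable D g ->
  rint D (fun x => f x + g x) = rint D f + rint D g.
Proof. by move=> fi gi; exact: (RintegralD (mitv _) fi gi). Qed.

Lemma rintB D f g : rintegrable D f -> rintegrable D g ->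
  rint D (fun x => f x - g x) = rint D f - rint D g.
Proof. by move=> fi gi; exact: (RintegralB (mitv _) fi gi). Qed.

Lemma rintZ D (r : R) f : rintegrable D f ->
  rint D (fun x => r * f x) = r * rint D f.
Proof. by move=> fi; exact: (RintegralZl r (mitv _) fi). Qed.

Lemma rintN D f : rintegrable D f -> rint D (fun x => - f x) = - rint D f.
Proof.
move=> fi; rewrite -mulN1r -rintZ//; congr (rint _ _).
by apply/funext => x; rewrite mulN1r.
Qed.

Lemma rint0 D : rint D (fun=> 0) = 0.
Proof. by rewrite /rint Rintegral_cst// mul0r. Qed.

Lemma eq_rint D f g : {in D, f =1 g} -> rint D f = rint D g.
Proof. by move=> fg; apply: eq_Rintegral => x /set_mem/=; exact: fg. Qed.

Lemma rint_sum D (I : Type) (r : seq I) (P : pred I) (F : I -> R -> R) :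
  (forall i, P i -> rintegrable D (F i)) ->
  rint D (fun x => \sum_(i <- r | P i) F i x) =
    \sum_(i <- r | P i) rint D (F i).
Proof.
move=> Fi; elim: r => [|i r IH].
  by under [in LHS]eq_fun do rewrite big_nil; rewrite big_nil rint0.
under [in LHS]eq_fun do rewrite big_cons.
rewrite big_cons -IH; case Pi : (P i) => //.
by rewrite rintD//; [exact: Fi|exact: rintegrable_sum].
Qed.

Lemma le_rint D f g : rintegrable D f -> rintegrable D g ->
  {in D, forall x, f x <= g x} -> rint D f <= rint D g.
Proof. by move=> fi gi fg; apply: (le_Rintegral (mitv _) fi gi). Qed.

Lemma rint_cst (a b r : R) : a <= b -> rint `[a, b] (fun=> r) = r * (b - a).
Proof.
move=> ab; rewrite /rint (Rintegral_cst _ (mitv _)); congr (_ * _).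
have -> : fine (@lebesgue_measure R `[a, b]) = b - a => //.
rewrite lebesgue_measure_itv/= lte_fin.
by move: ab; rewrite le_eqVlt => /predU1P[->|->//]; rewrite ltxx subrr.
Qed.

Lemma rintegrable_cst (a b r : R) : rintegrable `[a, b] (fun=> r).
Proof.
by apply: (bounded_rintegrable (M := `|r|)) => //; exact: measurable_cst.
Qed.

Lemma rint_split (a c b : R) f : a <= c <= b -> rintegrable `[a, b] f ->
  rint `[a, b] f = rint `[a, c] f + rint `[c, b] f.
Proof.
move=> /andP[ac cb] fi; apply/eqP; rewrite addrC -subr_eq; apply/eqP.
rewrite /rint Rintegral_itvB ?bnd_simp// Rintegral_itv_obnd_cbnd//.
apply: rintegrableS fi => x; rewrite !in_itv/= => /andP[cx ->].
by rewrite andbT (le_trans ac)// ltW.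
Qed.

Lemma le_norm_rint D f : rintegrable D f ->
  `|rint D f| <= rint D (fun x => `|f x|).
Proof. by move=> fi; exact: (le_normr_Rintegral (mitv _) fi). Qed.

Lemma rintegrable_norm D f : rintegrable D f -> rintegrable D (fun x => `|f x|).
Proof. by move=> fi; exact: (integrable_norm fi). Qed.

Lemma rint_set1 (a : R) f : rint `[a, a] f = 0.
Proof. by rewrite /rint set_itv1 Rintegral_set1. Qed.

Lemma rintegrable_measurable D f : rintegrable D f -> measurable_fun [set` D] f.
Proof. by move=> /measurable_int/measurable_EFinP. Qed.

End rintegrable_theory.


(** * Monotone majorants and the increment inequality *)

Lemma rintegrable_indic (R : realType) (a b : R) (A : set R) :
  measurable A -> rintegrable `[a, b] (\1_A).
Proof.
move=> mA; apply: (bounded_rintegrable (M := 1)) => [|x _].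
  exact: measurable_indic.
by rewrite indicE; case: (_ \in _); rewrite ?normr1 ?normr0.
Qed.

Lemma rint_indic (R : realType) (a b : R) (A : set R) :
  measurable A ->
  rint `[a, b] (\1_A) = fine (lebesgue_measure (A `&` `[a, b])).
Proof.
by move=> mA; rewrite /rint /Rintegral (integral_indic lebesgue_measure).
Qed.

Lemma sum_half_le1 (R : realType) (n : nat) :
  \sum_(k < n) (2^-1 : R) ^+ k.+1 <= 1.
Proof.
suff -> : \sum_(k < n) (2^-1 : R) ^+ k.+1 = 1 - 2^-1 ^+ n.
  by rewrite gerBl exprn_ge0.
elim: n => [|n IH]; first by rewrite big_ord0 expr0 subrr.
by rewrite big_ord_recr/= IH exprS; field.
Qed.

(** At most h / e + 1 of the levels k * e lie at or below h. In the induction, level n contributes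
    only if n * e <= h, and then the n earlier terms already sum to at most n * e <= h. *)
Lemma sum_levels_le (R : realType) (e h : R) (n : nat) : 0 < e -> 0 <= h ->
  \sum_(k < n) e * (k%:R * e <= h)%R%:R <= h + e.
Proof.
move=> e0 h0; elim: n => [|n IH]; first by rewrite big_ord0; lra.
rewrite big_ord_recr/=; case: (leP (n%:R * e) h) => hn;
  last by rewrite mulr0 addr0.
rewrite mulr1 lerD2r (le_trans _ hn)// mulr_natl -[in leRHS](card_ord n).
rewrite -sumr_const; apply: ler_sum => k _.
by case: (k%:R * e <= h); rewrite ?mulr1 ?mulr0 ?(ltW e0).
Qed.

(* A form of the Vitali-Caratheodory theorem: [Phi] is the integral of the
   lower semicontinuous function sum_k eps * 1_(V_k), where the open set V_k
   is slightly larger than {k * eps <= h}. *)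
Lemma ex_majorant (R : realType) (a b e : R) (h : R -> R) :
  a < b -> 0 < e -> rintegrable `[a, b] h ->
  (forall x, x \in `[a, b] -> 0 <= h x) ->
  exists Phi : R -> R,
    [/\ {in `[a, b] &, {homo Phi : x y / x <= y}},
        Phi b - Phi a <= rint `[a, b] h + e
      & forall x, a < x < b ->
          \forall t \near x^'+, h x * (t - x) <= Phi t - Phi x].
Proof.
move=> ab e0 hi h0.
(* Replacing h by its levels costs eps * (b - a), and enlarging the level sets to open sets costs
   eps; together this is e. *)
pose eps := e / (b - a + 1).
have ba0 : 0 < b - a + 1 by lra.
have eps0 : 0 < eps by rewrite divr_gt0.
have epsE : eps * (b - a) + eps = e.
  by rewrite -[X in _ + X]mulr1 -mulrDr /eps divfK// gt_eqF.
pose E k := `[a, b] `&` [set x | k%:R * eps <= h x].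
have mE k : measurable (E k).
  rewrite (_ : E k = `[a, b] `&` h @^-1` `[k%:R * eps, +oo[).
    by apply: (rintegrable_measurable hi); exact: measurable_itv.
  by apply/seteqP; split => x [xab hx]; split => //;
    move: hx; rewrite /= in_itv/= andbT.
have Ey k : (lebesgue_measure (E k) < +oo)%E.
  by apply: (@lebesgue_measure_itv_lty _ a b) => // x [].
(* Outer regularity. The excess measures 2^-(k+1) sum to at most 1, so all the enlargements together
   cost at most eps. *)
have /choice[V VP] : forall k, exists U : set R,
    [/\ open U, E k `<=` U &
      (lebesgue_measure (U `\` E k) < ((2^-1 : R) ^+ k.+1)%:E)%E].
  move=> k; apply: (lebesgue_regularity_outer (mE k) (Ey k)).
  by rewrite exprn_gt0// invr_gt0.
have mV k : measurable (V k) by have [/open_measurable] := VP k.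
have mVE k : measurable (V k `\` E k) by exact: measurableD.
(* The partial sums [g n] over the open sets are at most [s n + r n]: [s n] uses the level sets
   themselves and [r n] the excess. *)
pose g n x := \sum_(k < n) eps * \1_(V k) x.
pose s n x := \sum_(k < n) eps * \1_(E k) x.
pose r n x := \sum_(k < n) eps * \1_(V k `\` E k) x.
have gi c d n : rintegrable `[c, d] (g n).
  apply: rintegrable_sum => k _; apply: rintegrableZ; exact: rintegrable_indic.
have g_ge0 n x : 0 <= g n x.
  by apply: sumr_ge0 => k _; rewrite mulr_ge0// ltW.
have si n : rintegrable `[a, b] (s n).
  apply: rintegrable_sum => k _; apply: rintegrableZ.
  exact: rintegrable_indic.
have ri n : rintegrable `[a, b] (r n).
  apply: rintegrable_sum => k _; apply: rintegrableZ; apply: rintegrable_indic.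
  exact: mVE.
have g_le n : rint `[a, b] (g n) <= rint `[a, b] h + e.
  apply: (@le_trans _ _ (rint `[a, b] (s n) + rint `[a, b] (r n))).
    rewrite -rintD//; apply: le_rint => // [|x _]; first exact: rintegrableD.
    rewrite /s /r -big_split/=; apply: ler_sum => k _.
    rewrite -mulrDr ler_pM2l// !indicE in_setD.
    by case: (x \in V k); case: (x \in E k) => /=; lra.
  have s_le : rint `[a, b] (s n) <= rint `[a, b] h + eps * (b - a).
    rewrite -(@rint_cst _ a b eps (ltW ab)) -rintD//;
      last exact: rintegrable_cst.
    apply: le_rint => // [|x xab].
      by apply: rintegrableD => //; exact: rintegrable_cst.
    apply: le_trans (sum_levels_le n eps0 (h0 _ xab)); apply: ler_sum => k _.
    rewrite ler_pM2l// indicE; case: (leP (k%:R * eps) (h x)) => hx.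
      by case: (x \in E k).
    by rewrite memNset// => -[_]/=; rewrite leNgt hx.
  have r_le : rint `[a, b] (r n) <= eps.
    rewrite /r rint_sum; last first.
      move=> k _; apply: rintegrableZ; apply: rintegrable_indic; exact: mVE.
    apply: (@le_trans _ _ (\sum_(k < n) eps * (2^-1 : R) ^+ k.+1)); last first.
      by rewrite -mulr_sumr ler_piMr// ?sum_half_le1// ltW.
    apply: ler_sum => k _; rewrite rintZ; last first.
      by apply: rintegrable_indic; exact: mVE.
    rewrite ler_pM2l// rint_indic; last exact: mVE.
    have [_ _ /ltW VE] := VP k.
    rewrite -lee_fin fineK; last first.
      rewrite ge0_fin_numE//; apply: (@lebesgue_measure_itv_lty _ a b) => //.
      by apply: measurableI => //; exact: mVE.
    apply: le_trans VE; apply: le_measure; last by move=> x [].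
      by rewrite inE; apply: measurableI => //; exact: mVE.
    by rewrite inE; exact: mVE.
  by rewrite -epsE; lra.
pose P n x := rint `[a, x] (g n).
have PB n x y : a <= x -> x <= y -> P n y - P n x = rint `[x, y] (g n).
  by move=> ax xy; rewrite /P (@rint_split _ a x y) ?ax ?xy// addrC addKr.
have rint_ge0 n x y : 0 <= rint `[x, y] (g n).
  by rewrite -(@rint0 R `[x, y]); apply: le_rint => //; exact: rintegrable0.
have ndP n x y : a <= x -> x <= y -> P n x <= P n y.
  by move=> ax xy; rewrite -subr_ge0 PB.
(* The integrals of the partial sums increase with n and are bounded by the estimate [g_le]; their
   limit is the majorant. *)
have P_cvg x : x \in `[a, b] -> cvgn (P ^~ x).
  rewrite in_itv/= => /andP[ax xb].
  apply: nondecreasing_is_cvgn.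
    move=> n m nm; apply: le_rint => // y _; rewrite /g.
    rewrite -(subnKC nm) big_split_ord/= lerDl sumr_ge0// => k _.
    by rewrite mulr_ge0// ltW.
  exists (rint `[a, b] h + e) => _ [n _ <-].
  by apply: le_trans (g_le n); exact: ndP.
have aab : a \in `[a, b] by rewrite in_itv/= lexx ltW.
have bab : b \in `[a, b] by rewrite in_itv/= lexx ltW.
have PhiB x y : x \in `[a, b] -> y \in `[a, b] ->
    P n y - P n x @[n --> \oo] --> limn (P ^~ y) - limn (P ^~ x).
  by move=> xab yab; apply: cvgB; exact: P_cvg.
exists (fun x => limn (P ^~ x)); split.
- move=> x y xab yab xy; rewrite -subr_ge0.
  rewrite -(cvg_lim (@Rhausdorff R) (PhiB x y xab yab)).
  apply: limr_ge; first by apply/cvg_ex; eexists; exact: PhiB.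
  by near=> n; rewrite subr_ge0 ndP//; move: xab; rewrite in_itv => /andP[].
- rewrite -(cvg_lim (@Rhausdorff R) (PhiB a b aab bab)).
  apply: limr_le; first by apply/cvg_ex; eexists; exact: PhiB.
  by near=> n; rewrite PB ?g_le ?(ltW ab).
move=> x /andP[ax xb].
have xab : x \in `[a, b] by rewrite in_itv/= !ltW.
have hx0 : 0 <= h x / eps by rewrite divr_ge0 ?h0// ltW.
have /andP[trunc_le le_trunc] := truncn_itv hx0.
(* The levels 0, ..., K - 1 are exactly those at or below h x. The finitely many open sets [V k]
   with k < K share a ball around x, on which [g n] is at least K * eps > h x as soon as n >= K. *)
set K := (Num.truncn (h x / eps)).+1 in le_trunc.
have /(nbhs_ballP _ _)[d /= d0 dV] : \forall t \near x, forall k : 'I_K, V k t.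
  suff : forall k : 'I_K, \forall t \near x, V k t by move/filter_forall.
  move=> k; have [oV EV _] := VP k.
  apply: open_nbhs_nbhs; split => //; apply: EV; split => //=.
  apply: le_trans (_ : (Num.truncn (h x / eps))%:R * eps <= _); last first.
    by rewrite -ler_pdivlMr.
  by rewrite ler_pM2r// ler_nat -ltnS ltn_ord.
near=> t.
have xt : x < t by near: t; exact: nbhs_right_gt.
have tb : t <= b by near: t; exact: nbhs_right_le.
have td : t < x + d by near: t; apply: nbhs_right_lt; lra.
have tab : t \in `[a, b] by rewrite in_itv/= tb (le_trans (ltW ax))// ltW.
rewrite -(cvg_lim (@Rhausdorff R) (PhiB x t xab tab)).
apply: limr_ge; first by apply/cvg_ex; eexists; exact: PhiB.
exists K => // n /= Kn; rewrite PB ?(ltW ax) ?(ltW xt)//.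
rewrite -(@rint_cst _ x t (h x)) ?(ltW xt)//.
apply: le_rint => // [|y]; first exact: rintegrable_cst.
rewrite in_itv/= => /andP[xy yt].
rewrite /g -(subnKC Kn) big_split_ord/=.
apply: (@le_trans _ _ (K%:R * eps)); first by rewrite -ler_pdivrMr// ltW.
rewrite -[leLHS]addr0 lerD//; last first.
  by apply: sumr_ge0 => k _; rewrite mulr_ge0// ltW.
rewrite mulr_natl -[in leLHS](card_ord K) -sumr_const; apply: ler_sum => k _.
rewrite indicE mem_set ?mulr1//; apply: dV.
by rewrite /ball/= ler0_norm ?subr_le0//; lra.
Unshelve. all: by end_near. Qed.

(** Dominated convergence for the truncations of g from below at -n. A truncated function becomes
    nonnegative after adding a constant, as [ex_majorant] demands. *)
Lemma rint_truncate_le (R : realType) (a b e : R) (g : R -> R) :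
  rintegrable `[a, b] g -> 0 < e ->
  exists N : nat, rintegrable `[a, b] (fun x => Num.max (g x) (- N%:R)) /\
    rint `[a, b] (fun x => Num.max (g x) (- N%:R)) <= rint `[a, b] g + e.
Proof.
move=> gi e0; pose G n x := Num.max (g x) (- n%:R).
have mG n : measurable_fun `[a, b] (G n).
  apply: measurable_maxr; first exact: rintegrable_measurable.
  exact: measurable_cst.
have G_le n x : `|G n x| <= `|g x|.
  have n0 : 0 <= n%:R :> R by [].
  rewrite /G /Num.max; case: (ltP (g x) (- n%:R)) => // gn.
  by rewrite normrN ger0_norm// ler0_norm; lra.
have Gi n : rintegrable `[a, b] (G n).
  apply: (le_integrable _ _ _ (rintegrable_norm gi)) => //.
    by apply/measurable_EFinP; exact: mG.
  by move=> x _ /=; rewrite lee_fin normr_id.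
have Glim : rint `[a, b] (G n) @[n --> \oo] --> rint `[a, b] g.
  apply: fine_cvg; rewrite fineK; last by apply: (integrable_fin_num _ gi).
  apply: (dominated_cvg _ _ _ _ (rintegrable_norm gi)) => //.
  - by move=> n; apply/measurable_EFinP; exact: mG.
  - move=> x _; apply: cvg_near_cst; near=> n.
    rewrite /G max_l// lerNl; near: n; exact: nbhs_infty_ger.
  - by move=> n x _; rewrite lee_fin.
have /cvgrPdist_le/(_ e e0) := Glim => -[N _ /(_ N (leqnn _))] /=.
rewrite ler_norml lerNl opprB lerBlDl => /andP[h _].
by exists N; split; [exact: Gi|exact: h].
Unshelve. all: by end_near. Qed.

(** Truncating g at -N and adding N gives a nonnegative h with a majorant [Phi], so f x + N x is
    compared with Phi x + c x. The slack c x absorbs the error in the definition of the derivative.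
    Truncation, majorant and slack cost e / 3 each. *)
Lemma increment_le_rint (R : realType) (a b : R) (f g : R -> R) (S : seq R) :
  a < b -> {within `[a, b], continuous f} -> rintegrable `[a, b] g ->
  (forall x, x \in `]a, b[ -> x \notin S -> is_derive x 1 f (g x)) ->
  f b - f a <= rint `[a, b] g.
Proof.
move=> ab cf gi df; apply/ler_addgt0Pr => e e0.
have e3 : 0 < e / 3 by lra.
have [N [Gi G_le]] := rint_truncate_le gi e3.
pose h x := Num.max (g x) (- N%:R) + N%:R.
have hi : rintegrable `[a, b] h.
  by apply: rintegrableD => //; exact: rintegrable_cst.
have h0 x : x \in `[a, b] -> 0 <= h x.
  by move=> _; rewrite /h -lerBlDr sub0r le_max lexx orbT.
have [Phi [ndPhi Phi_le Phi_ge]] := ex_majorant ab e3 hi h0.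
have hE : rint `[a, b] h =
    rint `[a, b] (fun x => Num.max (g x) (- N%:R)) + N%:R * (b - a).
  by rewrite /h rintD ?rint_cst ?ltW//; exact: rintegrable_cst.
pose c := e / 3 / (b - a).
have c0 : 0 < c by rewrite divr_gt0// subr_gt0.
have cE : c * (b - a) = e / 3 by rewrite divfK// subr_eq0 gt_eqF.
pose f' x := f x + N%:R * x.
pose Phi' x := Phi x + c * x.
suff : f' b - f' a <= Phi' b - Phi' a.
  by rewrite /f' /Phi'; move: Phi_le G_le; rewrite hE; nra.
apply: (@le_increment_of_right _ a b f' Phi' S) => //; first exact: ltW.
- have cN : {within `[a, b], continuous (fun x : R => N%:R * x)}.
    by apply: continuous_subspaceT; exact: mulrl_continuous.
  by move=> x; apply: cvgD; [exact: cf|exact: cN].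
- move=> x y xab yab xy; rewrite /Phi' lerD ?ndPhi//.
  by rewrite ler_pM2l.
move=> x xab xS; have xab' : x \in `]a, b[ by rewrite in_itv.
have [d d0 fx] := is_derive_ball (df x xab' xS) c0.
near=> t.
have xt : x < t by near: t; exact: nbhs_right_gt.
have td : t < x + d by near: t; apply: nbhs_right_lt; lra.
have /fx : `|t - x| < d by rewrite gtr0_norm ?subr_gt0//; lra.
rewrite [`|t - x|]gtr0_norm ?subr_gt0// ler_norml => /andP[_ h1].
have h2 : h x * (t - x) <= Phi t - Phi x by near: t; exact: Phi_ge.
have h3 : (g x + N%:R) * (t - x) <= h x * (t - x).
  by rewrite ler_pM2r ?subr_gt0// /h lerD2r le_max lexx.
by rewrite /f' /Phi'; lra.
Unshelve. all: by end_near. Qed.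

(** The increment inequality for f and for -f gives both bounds. *)
Theorem rint_derive (R : realType) (a b : R) (f g : R -> R) (S : seq R) :
  a <= b -> {within `[a, b], continuous f} -> rintegrable `[a, b] g ->
  (forall x, x \in `]a, b[ -> x \notin S -> is_derive x 1 f (g x)) ->
  rint `[a, b] g = f b - f a.
Proof.
rewrite le_eqVlt => /predU1P[<- _ _ _|ab cf gi df].
  by rewrite rint_set1 subrr.
apply/eqP; rewrite eq_le (increment_le_rint ab cf gi df) andbT.
suff : - f b - - f a <= rint `[a, b] (fun x => - g x) by rewrite rintN//; lra.
apply: (@increment_le_rint _ a b (fun x => - f x) (fun x => - g x) S) => //.
- by move=> x; apply: cvgN; exact: cf.
- exact: rintegrableN.
- by move=> x xab xS; apply: is_deriveN; exact: df.
Qed.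

(** * Complex-valued functions *)

Lemma within_continuous_ext (R : realType) (a b : R) (f g : R -> R) :
  {in `[a, b], f =1 g} ->
  {within `[a, b], continuous f} -> {within `[a, b], continuous g}.
Proof.
move=> fg cf; apply: (subspace_eq_continuous _ cf) => x /set_mem xab.
exact: fg.
Qed.

Lemma within_continuous_bounded (R : realType) (a b : R) (f : R -> R) :
  a <= b -> {within `[a, b], continuous f} ->
  exists2 M, 0 <= M & forall x, x \in `[a, b] -> `|f x| <= M.
Proof.
move=> ab cf; have [c _ cmax] := EVT_max ab cf.
have [d _ dmin] := EVT_min ab cf.
exists (Num.max `|f c| `|f d|); first by rewrite le_max normr_ge0.
move=> x xab; rewrite ler_norml; apply/andP; split.
  rewrite lerNl; apply: (@le_trans _ _ (- f d)); first by rewrite lerN2 dmin.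
  by rewrite le_max -[`|f d|]normrN ler_norm orbT.
by rewrite (le_trans (cmax x xab))// le_max ler_norm.
Qed.

Lemma rintegrableM (R : realType) (a b : R) (f g : R -> R) :
  {within `[a, b], continuous f} -> rintegrable `[a, b] g ->
  rintegrable `[a, b] (fun x => f x * g x).
Proof.
move=> cf gi; have [ab|ba] := leP a b; last first.
  apply: eq_rintegrable (rintegrable0 _) => x; rewrite in_itv/= => /andP[ax xb].
  by move: (le_lt_trans (le_trans ax xb) ba); rewrite ltxx.
have [M M0 fM] := within_continuous_bounded ab cf.
apply: (le_integrable _ _ _ (rintegrableZ M (rintegrable_norm gi))) => //.
  apply/measurable_EFinP; apply: measurable_funM.
    by apply: subspace_continuous_measurable_fun => //; exact: measurable_itv.
  exact: rintegrable_measurable.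
move=> x xab /=; rewrite lee_fin normrM [leRHS]ger0_norm ?mulr_ge0//.
by rewrite ler_wpM2r// fM.
Qed.

Local Notation Re := complex.Re.
Local Notation Im := complex.Im.

Section complex_parts.
Context {R : realType}.
Implicit Types (a b : R[i]).

Lemma ReD a b : Re (a + b) = Re a + Re b. Proof. by case: a; case: b. Qed.
Lemma ImD a b : Im (a + b) = Im a + Im b. Proof. by case: a; case: b. Qed.
Lemma ReM a b : Re (a * b) = Re a * Re b - Im a * Im b.
Proof. by case: a; case: b. Qed.
Lemma ImM a b : Im (a * b) = Re a * Im b + Im a * Re b.
Proof. by case: a; case: b. Qed.
Lemma ReV a : Re a^-1 = Re a / (Re a ^+ 2 + Im a ^+ 2).
Proof. by case: a. Qed.
Lemma ImV a : Im a^-1 = - (Im a / (Re a ^+ 2 + Im a ^+ 2)).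
Proof. by case: a. Qed.
Lemma sqr_normc_neq0 a : a != 0 -> Re a ^+ 2 + Im a ^+ 2 != 0.
Proof.
case: a => x y; apply: contra => /=.
by rewrite paddr_eq0 ?sqr_ge0// !sqrf_eq0 eq_complex.
Qed.

End complex_parts.

Section complex_valued.
Context {R : realType}.
Implicit Types (f g : R -> R[i]) (d e c : R[i]) (t T : R).

(** This and the following notions unfold to the clause for a single entry in [mx_continuous_on],
    [mx_is_derive], [mx_integrable_on] and [mx_int], so entrywise facts about matrices can be passed
    to them directly. *)
Definition ccont T f :=
  {within `[0, T], continuous (fun x => Re (f x))} /\
  {within `[0, T], continuous (fun x => Im (f x))}.

Definition is_cderive t f d :=
  is_derive t 1 (fun x => Re (f x)) (Re d) /\
  is_derive t 1 (fun x => Im (f x)) (Im d).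

(** Meant for determinants and adjugates, whose derivatives need not be known explicitly. *)
Definition cderivable t f := exists d, is_cderive t f d.

Definition cintegrable T f :=
  rintegrable `[0, T] (fun x => Re (f x)) /\
  rintegrable `[0, T] (fun x => Im (f x)).

Definition cint f t : R[i] :=
  (rint `[0, t] (fun x => Re (f x)) +i* rint `[0, t] (fun x => Im (f x)))%C.

Lemma ccont_ext T f g : {in `[0, T], f =1 g} -> ccont T f -> ccont T g.
Proof.
by move=> fg [fr fi]; split; [move: fr|move: fi];
  apply: within_continuous_ext => x /fg ->.
Qed.

Lemma ccont_cst T c : ccont T (fun=> c).
Proof. by split => x; exact: cvg_cst. Qed.

Lemma ccontD T f g : ccont T f -> ccont T g -> ccont T (fun x => f x + g x).
Proof.
move=> [fr fi] [gr gi]; split.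
  apply: (@within_continuous_ext _ _ _ (fun x => Re (f x) + Re (g x))) => x.
    by rewrite ReD.
  by apply: cvgD; [exact: fr|exact: gr].
apply: (@within_continuous_ext _ _ _ (fun x => Im (f x) + Im (g x))) => x.
  by rewrite ImD.
by apply: cvgD; [exact: fi|exact: gi].
Qed.

Lemma ccontM T f g : ccont T f -> ccont T g -> ccont T (fun x => f x * g x).
Proof.
move=> [fr fi] [gr gi]; split.
  apply: (@within_continuous_ext _ _ _
    (fun x => Re (f x) * Re (g x) - Im (f x) * Im (g x))) => x.
    by rewrite ReM.
  apply: cvgB; first by apply: cvgM; [exact: fr|exact: gr].
  by apply: cvgM; [exact: fi|exact: gi].
apply: (@within_continuous_ext _ _ _
  (fun x => Re (f x) * Im (g x) + Im (f x) * Re (g x))) => x.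
  by rewrite ImM.
apply: cvgD; first by apply: cvgM; [exact: fr|exact: gi].
by apply: cvgM; [exact: fi|exact: gr].
Qed.

Lemma ccont_sum T (I : Type) (r : seq I) (P : pred I) (F : I -> R -> R[i]) :
  (forall i, P i -> ccont T (F i)) ->
  ccont T (fun x => \sum_(i <- r | P i) F i x).
Proof.
move=> Fc; elim: r => [|i r IH].
  by under eq_fun do rewrite big_nil; exact: ccont_cst.
under eq_fun do rewrite big_cons.
by case Pi : (P i) => //; apply: ccontD => //; exact: Fc.
Qed.

Lemma ccont_prod T (I : Type) (r : seq I) (P : pred I) (F : I -> R -> R[i]) :
  (forall i, P i -> ccont T (F i)) ->
  ccont T (fun x => \prod_(i <- r | P i) F i x).
Proof.
move=> Fc; elim: r => [|i r IH].
  by under eq_fun do rewrite big_nil; exact: ccont_cst.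
under eq_fun do rewrite big_cons.
by case Pi : (P i) => //; apply: ccontM => //; exact: Fc.
Qed.

Lemma ccontV T f : (forall x, x \in `[0, T] -> f x != 0) ->
  ccont T f -> ccont T (fun x => (f x)^-1).
Proof.
move=> f0 [/subspace_continuousP fr /subspace_continuousP fi].
have cV x : `[0, T]%classic x ->
    (Re (f y) ^+ 2 + Im (f y) ^+ 2)^-1 @[y --> within `[0, T] (nbhs x)] -->
    (Re (f x) ^+ 2 + Im (f x) ^+ 2)^-1.
  move=> xT; apply: cvgV; first by rewrite sqr_normc_neq0// f0.
  by apply: cvgD; apply: cvgM; by [exact: fr|exact: fi].
split.
  apply: (@within_continuous_ext _ _ _
    (fun x => Re (f x) / (Re (f x) ^+ 2 + Im (f x) ^+ 2))) => [x _|].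
    by rewrite ReV.
  by apply/subspace_continuousP => x xT; apply: cvgM; [exact: fr|exact: cV].
apply: (@within_continuous_ext _ _ _
  (fun x => - (Im (f x) / (Re (f x) ^+ 2 + Im (f x) ^+ 2)))) => [x _|].
  by rewrite ImV.
apply/subspace_continuousP => x xT; apply: cvgN.
by apply: cvgM; [exact: fi|exact: cV].
Qed.

Lemma is_cderive_cst t c : is_cderive t (fun=> c) 0.
Proof. by split; exact: is_derive_cst. Qed.

Lemma is_cderiveD t f g d e : is_cderive t f d -> is_cderive t g e ->
  is_cderive t (fun x => f x + g x) (d + e).
Proof.
move=> [fr fi] [gr gi]; split; rewrite ?ReD ?ImD.
  by under eq_fun do rewrite ReD; exact: is_deriveD fr gr.
by under eq_fun do rewrite ImD; exact: is_deriveD fi gi.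
Qed.

Lemma is_cderiveM t f g d e : is_cderive t f d -> is_cderive t g e ->
  is_cderive t (fun x => f x * g x) (d * g t + f t * e).
Proof.
move=> [fr fi] [gr gi]; split.
  under eq_fun do rewrite ReM.
  apply: (is_derive_eq (is_deriveB (is_deriveM fr gr) (is_deriveM fi gi))).
  by rewrite ReD !ReM /GRing.scale/=; ring.
under eq_fun do rewrite ImM.
apply: (is_derive_eq (is_deriveD (is_deriveM fr gi) (is_deriveM fi gr))).
by rewrite ImD !ImM /GRing.scale/=; ring.
Qed.

Lemma is_cderive_sum t (I : Type) (r : seq I) (P : pred I) (F : I -> R -> R[i])
    (D : I -> R[i]) :
  (forall i, P i -> is_cderive t (F i) (D i)) ->
  is_cderive t (fun x => \sum_(i <- r | P i) F i x) (\sum_(i <- r | P i) D i).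
Proof.
move=> Fc; elim: r => [|i r IH].
  by under eq_fun do rewrite big_nil; rewrite big_nil; exact: is_cderive_cst.
under eq_fun do rewrite big_cons; rewrite big_cons.
by case Pi : (P i) => //; apply: is_cderiveD => //; exact: Fc.
Qed.

Lemma cderivableD t f g :
  cderivable t f -> cderivable t g -> cderivable t (fun x => f x + g x).
Proof.
by move=> [d fd] [e ge]; exists (d + e); apply: is_cderiveD fd ge.
Qed.

Lemma cderivableM t f g :
  cderivable t f -> cderivable t g -> cderivable t (fun x => f x * g x).
Proof.
move=> [d fd] [e ge]; exists (d * g t + f t * e).
by apply: is_cderiveM fd ge.
Qed.

Lemma cderivable_cst t c : cderivable t (fun=> c).
Proof. by exists 0; exact: is_cderive_cst. Qed.

Lemma cderivable_sum t (I : Type) (r : seq I) (P : pred I)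
    (F : I -> R -> R[i]) :
  (forall i, P i -> cderivable t (F i)) ->
  cderivable t (fun x => \sum_(i <- r | P i) F i x).
Proof.
move=> Fc; elim: r => [|i r IH].
  by under eq_fun do rewrite big_nil; exact: cderivable_cst.
under eq_fun do rewrite big_cons.
by case Pi : (P i); [apply: cderivableD IH; exact: Fc|exact: IH].
Qed.

Lemma cderivable_prod t (I : Type) (r : seq I) (P : pred I)
    (F : I -> R -> R[i]) :
  (forall i, P i -> cderivable t (F i)) ->
  cderivable t (fun x => \prod_(i <- r | P i) F i x).
Proof.
move=> Fc; elim: r => [|i r IH].
  by under eq_fun do rewrite big_nil; exact: cderivable_cst.
under eq_fun do rewrite big_cons.
by case Pi : (P i); [apply: cderivableM IH; exact: Fc|exact: IH].
Qed.

Lemma cderivableV t f :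
  f t != 0 -> cderivable t f -> cderivable t (fun x => (f x)^-1).
Proof.
move=> f0 [d [fr fi]].
have n0 := sqr_normc_neq0 f0.
pose n := (fun x => Re (f x)) * (fun x => Re (f x)) +
  (fun x => Im (f x)) * (fun x => Im (f x)).
have dn := is_deriveV (f := n) n0
  (is_deriveD (is_deriveM fr fr) (is_deriveM fi fi)).
have dr := is_deriveM fr dn.
have di := is_deriveN (is_deriveM fi dn).
eexists (_ +i* _)%C; split.
  under eq_fun do rewrite ReV; exact: dr.
under eq_fun do rewrite ImV; exact: di.
Qed.

Lemma is_cderive_near_unique t f g d e :
  (\forall x \near t, f x = g x) ->
  is_cderive t f d -> is_cderive t g e -> d = e.
Proof.
move=> fg [fr fi] [gr gi]; apply/eqP; rewrite eq_complex; apply/andP; split.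
  rewrite -(@derive_val _ _ _ _ _ _ _ fr) -(@derive_val _ _ _ _ _ _ _ gr).
  apply/eqP; apply: near_eq_derive.
  by apply: filterS fg => x ->.
rewrite -(@derive_val _ _ _ _ _ _ _ fi) -(@derive_val _ _ _ _ _ _ _ gi).
apply/eqP; apply: near_eq_derive.
by apply: filterS fg => x ->.
Qed.

Lemma cintegrableD T f g :
  cintegrable T f -> cintegrable T g -> cintegrable T (fun x => f x + g x).
Proof.
move=> [fr fi] [gr gi]; split.
  by under eq_fun do rewrite ReD; exact: rintegrableD.
by under eq_fun do rewrite ImD; exact: rintegrableD.
Qed.

Lemma cintegrable0 T : cintegrable T (fun=> 0).
Proof. by split; exact: rintegrable0. Qed.

Lemma cintegrable_sum T (I : Type) (r : seq I) (P : pred I)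
    (F : I -> R -> R[i]) :
  (forall i, P i -> cintegrable T (F i)) ->
  cintegrable T (fun x => \sum_(i <- r | P i) F i x).
Proof.
move=> Fc; elim: r => [|i r IH].
  by under eq_fun do rewrite big_nil; exact: cintegrable0.
under eq_fun do rewrite big_cons.
by case Pi : (P i) => //; apply: cintegrableD => //; exact: Fc.
Qed.

Lemma cintegrableM T f g :
  ccont T f -> cintegrable T g -> cintegrable T (fun x => f x * g x).
Proof.
move=> [fr fi] [gr gi]; split.
  by under eq_fun do rewrite ReM; apply: rintegrableB; exact: rintegrableM.
by under eq_fun do rewrite ImM; apply: rintegrableD; exact: rintegrableM.
Qed.

Lemma eq_cintegrable T f g :
  {in `[0, T], f =1 g} -> cintegrable T f -> cintegrable T g.
Proof.
by move=> fg [fr fi]; split; [move: fr|move: fi];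
  apply: eq_rintegrable => x /fg ->.
Qed.

Lemma cintegrableS T t f : t <= T -> cintegrable T f -> cintegrable t f.
Proof.
move=> tT [fr fi]; split; [move: fr|move: fi]; apply: rintegrableS => x;
  by rewrite !in_itv/= => /andP[-> /le_trans ->].
Qed.

Lemma eq_cint t f g : {in `[0, t], f =1 g} -> cint f t = cint g t.
Proof. by move=> fg; congr (_ +i* _)%C; apply: eq_rint => x /fg ->. Qed.

Lemma cintD t f g : cintegrable t f -> cintegrable t g ->
  cint (fun x => f x + g x) t = cint f t + cint g t.
Proof.
move=> [fr fi] [gr gi]; apply/eqP; rewrite eq_complex /= -!rintD//.
by apply/andP; split; apply/eqP; apply: eq_rint => x _; rewrite ?ReD ?ImD.
Qed.

Lemma cint_sum t (I : Type) (r : seq I) (P : pred I) (F : I -> R -> R[i]) :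
  (forall i, P i -> cintegrable t (F i)) ->
  cint (fun x => \sum_(i <- r | P i) F i x) t =
    \sum_(i <- r | P i) cint (F i) t.
Proof.
move=> Fc; elim: r => [|i r IH].
  under [in LHS]eq_fun do rewrite big_nil.
  by rewrite big_nil /cint !rint0.
under [in LHS]eq_fun do rewrite big_cons.
rewrite big_cons -IH; case Pi : (P i) => //.
by rewrite cintD//; [exact: Fc|exact: cintegrable_sum].
Qed.

Lemma cintZ t c f : cintegrable t f -> cint (fun x => c * f x) t = c * cint f t.
Proof.
move=> [fr fi]; apply/eqP; rewrite eq_complex ReM ImM /= -!rintZ//.
apply/andP; split; apply/eqP.
  rewrite -rintB; [|exact: rintegrableZ..].
  by apply: eq_rint => x _; rewrite ReM.
rewrite -rintD; [|exact: rintegrableZ..].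
by apply: eq_rint => x _; rewrite ImM.
Qed.

Lemma ccont_cint T f : 0 <= T -> cintegrable T f -> ccont T (cint f).
Proof.
by move=> T0 [fr fi]; split; apply: parameterized_integral_continuous.
Qed.

Lemma cint_derive t f g (S : seq R) : 0 <= t -> ccont t f -> cintegrable t g ->
  (forall x, x \in `]0, t[ -> x \notin S -> is_cderive x f (g x)) ->
  cint g t = f t - f 0.
Proof.
move=> t0 [fr fi] [gr gi] fg.
rewrite /cint (rint_derive t0 fr gr (fun x xt xS => proj1 (fg x xt xS))).
rewrite (rint_derive t0 fi gi (fun x xt xS => proj2 (fg x xt xS))).
by case: (f t) => ? ?; case: (f 0).
Qed.

Lemma ccontS T t f : t <= T -> ccont T f -> ccont t f.
Proof.
move=> tT [fr fi].
have sub : `[0, t]%classic `<=` `[0, T]%classic.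
  by move=> x; rewrite /= !in_itv/= => /andP[-> /le_trans ->].
by split; apply: continuous_subspaceW sub _.
Qed.

End complex_valued.

(** * Uniqueness for linear equations *)

(** Absolute continuity of the Lebesgue integral, applied to f extended by zero outside [a, b]. *)
Lemma rintegrable_small (R : realType) (a b e : R) (f : R -> R) :
  rintegrable `[a, b] f -> 0 < e ->
  exists2 d, 0 < d & forall u v, a <= u -> u <= v -> v <= b -> v - u < d ->
    rint `[u, v] (fun x => `|f x|) < e.
Proof.
move=> fi e0.
have fsi : lebesgue_measure.-integrable setT (EFin \o (f \_ `[a, b])).
  by rewrite -restrict_EFin; apply/integrable_restrict => //=; rewrite setTI.
have [d [d0 H]] := integral_normr_continuous fsi e0.
exists d => // u v au uv vb vud.
have -> : rint `[u, v] (fun x => `|f x|) =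
    rint `[u, v] (fun x => `|(f \_ `[a, b]) x|).
  apply: eq_rint => x; rewrite in_itv/= => /andP[ux xv].
  by rewrite patchE mem_set//= in_itv/= (le_trans au ux) (le_trans xv vb).
have mE : @lebesgue_measure R `[u, v] = (v - u)%:E.
  rewrite lebesgue_measure_itv/= lte_fin.
  by move: uv; rewrite le_eqVlt => /predU1P[->|->//]; rewrite ltxx subrr.
apply: (H _ (measurable_itv `[u, v])); apply: (@le_lt_trans _ _ (v - u)%:E).
  by rewrite le_eqVlt; apply/orP; left; apply/eqP.
by rewrite lte_fin.
Qed.

Lemma rint_subset_le (R : realType) (u v c e : R) (f : R -> R) :
  c <= u -> u <= v -> v <= e -> rintegrable `[c, e] f ->
  {in `[c, e], forall x, 0 <= f x} ->
  rint `[u, v] f <= rint `[c, e] f.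
Proof.
move=> cu uv ve fi f0.
have ge0 x y : c <= x -> x <= y -> y <= e -> 0 <= rint `[x, y] f.
  move=> cx xy ye; have sub : {subset `[x, y] <= `[c, e]}.
    by move=> z; rewrite !in_itv/= => /andP[xz zy]; lra.
  rewrite -(@rint0 R `[x, y]); apply: le_rint; first exact: rintegrable0.
    exact: rintegrableS fi.
  by move=> z /sub; exact: f0.
rewrite (@rint_split _ c u e)//; last by rewrite cu (le_trans uv).
rewrite (@rint_split _ u v e) ?uv//; last first.
  by apply: rintegrableS fi => z; rewrite !in_itv/= => /andP[xz zy]; lra.
have := ge0 c u; have := ge0 v e; rewrite !lexx cu ve => /(_ _ _ _) h1 h2.
have := h1 (le_trans cu uv) erefl erefl.
have := h2 erefl erefl (le_trans uv ve).
by lra.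
Qed.

Lemma norm_increment_le (R : realType) (c e u v : R) (f g : R -> R)
    (S : seq R) :
  {within `[c, e], continuous f} -> rintegrable `[c, e] g ->
  (forall x, x \in `]c, e[ -> x \notin S -> is_derive x 1 f (g x)) ->
  u \in `[c, e] -> v \in `[c, e] ->
  `|f v - f u| <= rint `[c, e] (fun x => `|g x|).
Proof.
move=> cf gi df; wlog uv : u v / u <= v => [H uce vce|].
  by have [/H|/ltW/H] := leP u v; [exact|rewrite distrC; exact].
rewrite !in_itv/= => /andP[cu ue] /andP[cv ve].
have gi' : rintegrable `[u, v] g.
  by apply: rintegrableS gi => z; rewrite !in_itv/= => /andP[xz zy]; lra.
have cf' : {within `[u, v], continuous f}.
  apply: continuous_subspaceW cf => z /=.
  by rewrite !in_itv/= => /andP[xz zy]; lra.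
have df' x : x \in `]u, v[ -> x \notin S -> is_derive x 1 f (g x).
  move=> xuv xS; apply: df => //.
  by move: xuv; rewrite !in_itv/= => /andP[xz zy]; lra.
have <- := rint_derive uv cf' gi' df'.
apply: le_trans (le_norm_rint gi') _; apply: rint_subset_le => //.
exact: rintegrable_norm.
Qed.

(** * A submultiplicative norm on complex matrices *)

Section l1_norm.
Context {R : realType}.

(** Chosen instead of the modulus because integrals are taken separately on real and imaginary
    parts: the real estimates then add up without a constant. *)
Definition cl1 (z : R[i]) : R := `|Re z| + `|Im z|.

Definition mxl1 (N : nat) (A : 'M[R[i]]_N) : R := \sum_k \sum_l cl1 (A k l).

Lemma cl1_ge0 z : 0 <= cl1 z. Proof. by rewrite addr_ge0. Qed.

Lemma cl1D z w : cl1 (z + w) <= cl1 z + cl1 w.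
Proof. by rewrite /cl1 ReD ImD addrACA lerD// ler_normD. Qed.

Lemma cl1M z w : cl1 (z * w) <= cl1 z * cl1 w.
Proof.
rewrite /cl1 ReM ImM mulrDl !mulrDr -!normrM.
apply: (@le_trans _ _ ((`|Re z * Re w| + `|Im z * Im w|) +
  (`|Re z * Im w| + `|Im z * Re w|))); last by lra.
by rewrite lerD ?ler_normD// (le_trans (ler_normB _ _)).
Qed.

Lemma cl1_sum (I : Type) (r : seq I) (F : I -> R[i]) :
  cl1 (\sum_(i <- r) F i) <= \sum_(i <- r) cl1 (F i).
Proof.
elim: r => [|i r IH]; first by rewrite !big_nil /cl1/= normr0 addr0.
by rewrite !big_cons (le_trans (cl1D _ _))// lerD2l.
Qed.

Variable N : nat.
Implicit Types A B : 'M[R[i]]_N.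

Lemma mxl1_ge0 A : 0 <= mxl1 A.
Proof. by apply: sumr_ge0 => k _; apply: sumr_ge0 => l _; exact: cl1_ge0. Qed.

Lemma mxl1_eq0 A : mxl1 A <= 0 -> A = 0.
Proof.
move=> A0; have /eqP := le_anti (introT andP (conj A0 (mxl1_ge0 A))).
rewrite psumr_eq0; last by move=> k _; apply: sumr_ge0 => l _; exact: cl1_ge0.
move=> /allP H; apply/matrixP => k l; rewrite mxE; apply/eqP.
have /eqP := H k (mem_index_enum k) => /eqP.
rewrite psumr_eq0; last by move=> j _; exact: cl1_ge0.
move=> /allP /(_ l (mem_index_enum l)).
by rewrite /cl1 paddr_eq0// !normr_eq0 eq_complex.
Qed.

(** After exchanging the sums, each entry A k j is multiplied by the norm of row j of B, which is at
    most the norm of B. *)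
Lemma mxl1M A B : mxl1 (A *m B) <= mxl1 A * mxl1 B.
Proof.
rewrite /mxl1 mulr_suml; apply: ler_sum => k _.
apply: (@le_trans _ _ (\sum_l \sum_j cl1 (A k j) * cl1 (B j l))).
  apply: ler_sum => l _; rewrite mxE (le_trans (cl1_sum _ _))//.
  by apply: ler_sum => j _; exact: cl1M.
rewrite exchange_big mulr_suml; apply: ler_sum => j _ /=.
rewrite -mulr_sumr ler_wpM2l ?cl1_ge0//.
rewrite [leRHS](bigD1 j)//= lerDl sumr_ge0// => i _.
by apply: sumr_ge0 => l _; exact: cl1_ge0.
Qed.

End l1_norm.

(** * Calculus of matrix-valued functions and uniqueness for linear systems *)

Section matrix_valued.
Context {R : realType} {N : nat}.
Implicit Types (T t : R) (F G U V Y : R -> 'M[R[i]]_N) (P D E : 'M[R[i]]_N).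

Lemma mx_intE F t k l : mx_int F t k l = cint (fun x => F x k l) t.
Proof. by rewrite mxE. Qed.

Lemma mx_continuous_ext T U V : {in `[0, T], U =1 V} ->
  mx_continuous_on T U -> mx_continuous_on T V.
Proof.
by move=> UV cU k l; apply: (ccont_ext _ (cU k l)) => x /UV ->.
Qed.

Lemma mx_continuousM T U V : mx_continuous_on T U -> mx_continuous_on T V ->
  mx_continuous_on T (fun x => U x *m V x).
Proof.
move=> cU cV k l.
apply: (@ccont_ext _ _ (fun x => \sum_j U x k j * V x j l)) => [x _|].
  by rewrite mxE.
by apply: ccont_sum => j _; apply: ccontM; [exact: cU|exact: cV].
Qed.

Lemma mx_continuous_cst T P : mx_continuous_on T (fun=> P).
Proof. by move=> k l; exact: ccont_cst. Qed.

Lemma mx_continuousB T U V : mx_continuous_on T U -> mx_continuous_on T V ->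
  mx_continuous_on T (fun x => U x - V x).
Proof.
move=> cU cV k l.
apply: (@ccont_ext _ _ (fun x => U x k l + (-1) * V x k l)) => [x _|].
  by rewrite !mxE mulN1r.
apply: ccontD; first exact: cU.
by apply: ccontM; [exact: ccont_cst|exact: cV].
Qed.

Lemma mx_is_deriveM t U V D E : mx_is_derive t U D -> mx_is_derive t V E ->
  mx_is_derive t (fun x => U x *m V x) (D *m V t + U t *m E).
Proof.
move=> dU dV k l.
have -> : (D *m V t + U t *m E) k l =
    \sum_j (D k j * V t j l + U t k j * E j l).
  by rewrite !mxE -big_split.
under eq_fun do rewrite mxE.
under [X in _ /\ is_derive _ _ X _]eq_fun do rewrite mxE.
by apply: is_cderive_sum => j _; apply: is_cderiveM; [exact: dU|exact: dV].
Qed.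

Lemma mx_is_derive_cst t P : mx_is_derive t (fun=> P) 0.
Proof. by move=> k l; rewrite mxE; exact: is_cderive_cst. Qed.

Lemma mx_is_deriveB t U V D E : mx_is_derive t U D -> mx_is_derive t V E ->
  mx_is_derive t (fun x => U x - V x) (D - E).
Proof.
move=> dU dV k l.
have -> : (D - E) k l = D k l + (0 * V t k l + (-1) * E k l).
  by rewrite !mxE mul0r add0r mulN1r.
have eB x : (U x - V x) k l = U x k l + (-1) * V x k l.
  by rewrite !mxE mulN1r.
under eq_fun do rewrite eB.
under [X in _ /\ is_derive _ _ X _]eq_fun do rewrite eB.
apply: is_cderiveD; first exact: dU.
by apply: is_cderiveM; [exact: is_cderive_cst|exact: dV].
Qed.

Lemma mx_is_derive_near_unique t U V D E : (\forall x \near t, U x = V x) ->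
  mx_is_derive t U D -> mx_is_derive t V E -> D = E.
Proof.
move=> UV dU dV; apply/matrixP => k l.
by apply: is_cderive_near_unique (dU k l) (dV k l); apply: filterS UV => x ->.
Qed.

Lemma mx_integrableS T t F : t <= T ->
  mx_integrable_on T F -> mx_integrable_on t F.
Proof. by move=> tT iF k l; exact: cintegrableS tT (iF k l). Qed.

Lemma mx_integrableMl T U F : mx_continuous_on T U -> mx_integrable_on T F ->
  mx_integrable_on T (fun x => U x *m F x).
Proof.
move=> cU iF k l.
apply: (@eq_cintegrable _ _ (fun x => \sum_j U x k j * F x j l)) => [x _|].
  by rewrite mxE.
by apply: cintegrable_sum => j _; apply: cintegrableM; [exact: cU|exact: iF].
Qed.

Lemma mx_integrableMr T U F : mx_continuous_on T U -> mx_integrable_on T F ->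
  mx_integrable_on T (fun x => F x *m U x).
Proof.
move=> cU iF k l.
apply: (@eq_cintegrable _ _ (fun x => \sum_j U x j l * F x k j)) => [x _|].
  by rewrite mxE; apply: eq_bigr => j _; rewrite mulrC.
by apply: cintegrable_sum => j _; apply: cintegrableM; [exact: cU|exact: iF].
Qed.

Lemma mx_integrable_sum T (I : Type) (r : seq I) (Q : pred I)
    (F : I -> R -> 'M[R[i]]_N) :
  (forall i, Q i -> mx_integrable_on T (F i)) ->
  mx_integrable_on T (fun x => \sum_(i <- r | Q i) F i x).
Proof.
move=> iF k l.
apply: (@eq_cintegrable _ _ (fun x => \sum_(i <- r | Q i) F i x k l)) => [x _|].
  by rewrite summxE.
by apply: cintegrable_sum => i Qi; exact: iF.
Qed.

Lemma eq_mx_int t F G : {in `[0, t], F =1 G} -> mx_int F t = mx_int G t.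
Proof.
move=> FG; apply/matrixP => k l; rewrite !mx_intE.
by apply: eq_cint => x /FG ->.
Qed.

Lemma mx_int_sum t (I : Type) (r : seq I) (Q : pred I)
    (F : I -> R -> 'M[R[i]]_N) :
  (forall i, Q i -> mx_integrable_on t (F i)) ->
  mx_int (fun x => \sum_(i <- r | Q i) F i x) t =
    \sum_(i <- r | Q i) mx_int (F i) t.
Proof.
move=> iF; apply/matrixP => k l; rewrite mx_intE summxE.
under eq_bigr do rewrite mx_intE.
rewrite -cint_sum; last by move=> i Qi; exact: iF.
by apply: eq_cint => x _; rewrite summxE.
Qed.

Lemma mx_intMl t P F : mx_integrable_on t F ->
  mx_int (fun x => P *m F x) t = P *m mx_int F t.
Proof.
move=> iF; apply/matrixP => k l; rewrite mx_intE mxE.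
have PF j : cintegrable t (fun x => P k j * F x j l).
  by apply: cintegrableM; [exact: ccont_cst|exact: iF].
transitivity (\sum_j cint (fun x => P k j * F x j l) t).
  by rewrite -cint_sum//; apply: eq_cint => x _; rewrite mxE.
by apply: eq_bigr => j _; rewrite mx_intE cintZ//; exact: iF.
Qed.

Lemma mx_continuous_int T F : 0 <= T -> mx_integrable_on T F ->
  mx_continuous_on T (mx_int F).
Proof.
move=> T0 iF k l; apply: (ccont_ext _ (ccont_cint T0 (iF k l))) => x _.
by rewrite mx_intE.
Qed.

Lemma mx_int_derive t U F (S : seq R) : 0 <= t -> mx_continuous_on t U ->
  mx_integrable_on t F ->
  (forall x, x \in `]0, t[ -> x \notin S -> mx_is_derive x U (F x)) ->
  mx_int F t = U t - U 0.
Proof.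
move=> t0 cU iF dU; apply/matrixP => k l; rewrite mx_intE !mxE.
apply: (cint_derive (S := S) t0 (cU k l) (iF k l)) => x xt xS.
exact: dU x xt xS k l.
Qed.

Lemma mx_continuousS T t U : t <= T ->
  mx_continuous_on T U -> mx_continuous_on t U.
Proof. by move=> tT cU k l; exact: ccontS tT (cU k l). Qed.

Lemma rintegrable_mxl1 T F : mx_integrable_on T F ->
  rintegrable `[0, T] (fun x => mxl1 (F x)).
Proof.
move=> iF; apply: rintegrable_sum => k _; apply: rintegrable_sum => l _.
by have [fr fi] := iF k l; apply: rintegrableD; exact: rintegrable_norm.
Qed.

(** Sum of the scalar increment bounds over the real and imaginary parts of all entries. *)
Lemma mxl1_increment_le (c e u v T : R) Y F (S : seq R) : 0 <= c -> e <= T ->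
  mx_continuous_on T Y -> mx_integrable_on T F ->
  (forall x, x \in `]0, T[ -> x \notin S -> mx_is_derive x Y (F x)) ->
  u \in `[c, e] -> v \in `[c, e] ->
  mxl1 (Y v - Y u) <= rint `[c, e] (fun x => mxl1 (F x)).
Proof.
move=> c0 eT cY iF dY uce vce.
have sub : {subset `[c, e] <= `[0, T]}.
  by move=> z; rewrite !in_itv/= => /andP[? ?]; lra.
have sub' : {subset `]c, e[ <= `]0, T[}.
  by move=> z; rewrite !in_itv/= => /andP[? ?]; lra.
have iF' k l : rintegrable `[c, e] (fun x => Re (F x k l)) /\
    rintegrable `[c, e] (fun x => Im (F x k l)).
  by have [fr fi] := iF k l; split; apply: rintegrableS; eauto.
have il k l : rintegrable `[c, e] (fun x => cl1 (F x k l)).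
  by have [fr fi] := iF' k l; apply: rintegrableD; exact: rintegrable_norm.
rewrite rint_sum; last by move=> k _; apply: rintegrable_sum => l _.
apply: ler_sum => k _; rewrite rint_sum//; apply: ler_sum => l _.
have [fr fi] := iF' k l; have [cr ci] := cY k l.
have subc : `[c, e]%classic `<=` `[0, T]%classic by move=> z; exact: sub.
have eB : (Y v - Y u) k l = Y v k l + (-1) * Y u k l by rewrite !mxE mulN1r.
rewrite rintD; [|exact: rintegrable_norm..].
rewrite /cl1 eB ReD ImD ReM ImM /= oppr0 !mul0r subr0 addr0 !mulN1r.
apply: lerD.
  apply: (norm_increment_le (continuous_subspaceW subc cr) fr _ uce vce).
  move=> x xce xS.
  by have [] := dY x (sub' _ xce) xS k l.
apply: (norm_increment_le (continuous_subspaceW subc ci) fi _ uce vce).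
move=> x xce xS.
by have [] := dY x (sub' _ xce) xS k l.
Qed.

(* On an interval where the integral of |G| is at most 1/2, the supremum of |Y|
   is at most half of itself. *)
Lemma mx_ode_zero_local (c e u T : R) G Y (S : seq R) : 0 <= c -> e <= T ->
  mx_continuous_on T Y -> mx_integrable_on T G ->
  (forall x, x \in `]0, T[ -> x \notin S -> mx_is_derive x Y (G x *m Y x)) ->
  rint `[c, e] (fun x => mxl1 (G x)) <= 2^-1 ->
  u \in `[c, e] -> Y u = 0 ->
  forall t, t \in `[c, e] -> Y t = 0.
Proof.
move=> c0 eT cY iG dY half uce Yu0 t tce; apply: mxl1_eq0.
have sub : {subset `[c, e] <= `[0, T]}.
  by move=> z; rewrite !in_itv/= => /andP[? ?]; lra.
have subc : `[c, e]%classic `<=` `[0, T]%classic by move=> z; exact: sub.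
have ce : c <= e by move: uce; rewrite in_itv/= => /andP[? ?]; lra.
have cN : {within `[c, e], continuous (fun x => mxl1 (Y x))}.
  apply: (continuous_subspaceW subc); apply/subspace_continuousP => x xT.
  apply: cvg_big => [|k _]; first exact: add_continuous.
  apply: cvg_big => [|l _]; first exact: add_continuous.
  have [/subspace_continuousP cr /subspace_continuousP ci] := cY k l.
  by apply: cvgD; apply: cvg_norm; [exact: cr|exact: ci].
have [p pce pmax] := EVT_max ce cN.
apply: le_trans (pmax t tce) _.
have iG' : rintegrable `[c, e] (fun x => mxl1 (G x)).
  by apply: rintegrableS (rintegrable_mxl1 iG).
have : mxl1 (Y p) <= rint `[c, e] (fun x => mxl1 (G x *m Y x)).
  rewrite -[Y p]subr0 -Yu0.
  by apply: (mxl1_increment_le c0 eT cY _ dY uce pce); exact: mx_integrableMr.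
have : rint `[c, e] (fun x => mxl1 (G x *m Y x)) <=
    mxl1 (Y p) * rint `[c, e] (fun x => mxl1 (G x)).
  rewrite -rintZ//; apply: le_rint.
  - by apply: rintegrableS (rintegrable_mxl1 (mx_integrableMr cY iG)).
  - exact: rintegrableZ.
  - move=> x xce; rewrite (le_trans (mxl1M _ _))// mulrC ler_wpM2r ?mxl1_ge0//.
    exact: pmax.
have : mxl1 (Y p) * rint `[c, e] (fun x => mxl1 (G x)) <= mxl1 (Y p) * 2^-1.
  by rewrite ler_wpM2l ?mxl1_ge0.
by lra.
Qed.

(** By absolute continuity the integral of |G| is below 1/2 on every interval shorter than some d,
    so steps of length d / 2 carry the zero at u through [0, T] in both directions. Allowing any u,
    and not only 0, is what yields the invertibility of solutions. *)
Lemma mx_ode_zero (u T : R) G Y (S : seq R) :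
  mx_continuous_on T Y -> mx_integrable_on T G ->
  (forall x, x \in `]0, T[ -> x \notin S -> mx_is_derive x Y (G x *m Y x)) ->
  u \in `[0, T] -> Y u = 0 ->
  forall t, t \in `[0, T] -> Y t = 0.
Proof.
move=> cY iG dY u0T Yu0.
have half0 : 0 < 2^-1 :> R by rewrite invr_gt0.
have [d d0 dG] := rintegrable_small (rintegrable_mxl1 iG) half0.
pose h := d / 2.
have h0 : 0 < h by rewrite divr_gt0.
have hd : h < d by rewrite /h; lra.
have step (n : nat) (t : R) : t \in `[0, T] -> `|t - u| <= n%:R * h -> Y t = 0.
  elim: n t => [|n IH] t t0T.
    by rewrite mul0r normr_le0 subr_eq0 => /eqP ->.
  rewrite -natr1 mulrDl mul1r => tu.
  have [tle|tgt] := leP `|t - u| (n%:R * h); first exact: IH.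
  have nh0 : 0 <= n%:R * h by rewrite mulr_ge0// ltW.
  have local (c e v : R) : 0 <= c -> e <= T -> e - c < d -> v \in `[c, e] ->
      Y v = 0 -> t \in `[c, e] -> Y t = 0.
    move=> c0 eT ced vce Yv tce.
    have ce : c <= e by move: vce; rewrite in_itv/= => /andP[? ?]; lra.
    apply: (mx_ode_zero_local c0 eT cY iG dY _ vce Yv tce).
    have := dG c e c0 ce eT ced.
    under eq_rint => x _ do rewrite ger0_norm ?mxl1_ge0//.
    exact: ltW.
  move: t0T u0T; rewrite !in_itv/= => /andP[t0 tT] /andP[u0 uT].
  have [ut|tu'] := leP u t.
    move: tu tgt; rewrite ger0_norm ?subr_ge0// => tu tgt.
    pose v := u + n%:R * h.
    have v0 : 0 <= v by rewrite /v; lra.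
    have vt : v <= t by rewrite /v; lra.
    have Yv : Y v = 0.
      apply: IH; first by rewrite in_itv/=; lra.
      by rewrite /v addrC addKr ger0_norm.
    have tvd : t - v < d by rewrite /v; lra.
    by apply: (@local v t v v0 tT tvd _ Yv); rewrite in_itv/= lexx ?vt.
  move: tu tgt; rewrite ltr0_norm ?subr_lt0// => tu tgt.
  pose v := u - n%:R * h.
  have v0 : v <= T by rewrite /v; lra.
  have tv : t <= v by rewrite /v; lra.
  have Yv : Y v = 0.
    apply: IH; first by rewrite in_itv/=; lra.
    by rewrite /v addrC addKr normrN ger0_norm.
  have tvd : v - t < d by rewrite /v; lra.
  by apply: (@local t v v t0 v0 tvd _ Yv); rewrite in_itv/= lexx ?tv.
(* This many steps of length h cover the distance T, hence any |t - u|. *)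
move=> t t0T; apply: (step (Num.truncn (T / h)).+1) => //.
have T0 : 0 <= T by move: t0T; rewrite in_itv/= => /andP[? ?]; lra.
have /andP[_ /ltW] := @truncn_itv R (T / h) (divr_ge0 T0 (ltW h0)).
rewrite ler_pdivrMr//; apply: le_trans.
by move: t0T u0T; rewrite !in_itv/= ler_norml => /andP[? ?] /andP[? ?]; lra.
Qed.

End matrix_valued.

(** * Initial value problems and time-ordered exponentials *)

Section ivp.
Context {R : realType} {N : nat}.
Implicit Types (T t : R) (G U V W : R -> 'M[R[i]]_N).

(** The difference of two solutions vanishes at 0 and satisfies the same linear equation off the
    union of the two exceptional sets. *)
Lemma ivp_solution_unique T G U : mx_integrable_on T G ->
  is_ivp_solution T G U -> is_unique_ivp_solution T G U.
Proof.
move=> iG solU; split => // V [cV V0 [S1 dV]] t t0T.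
have [cU U0 [S2 dU]] := solU.
have T0 : 0 <= T by move: t0T; rewrite in_itv/= => /andP[/le_trans]; exact.
apply/eqP; rewrite -subr_eq0; apply/eqP.
apply: (@mx_ode_zero _ _ 0 T G (fun x => V x - U x) (S1 ++ S2)) => //.
- exact: mx_continuousB.
- move=> x x0T; rewrite mem_cat negb_or => /andP[xS1 xS2].
  by rewrite mulmxBr; apply: mx_is_deriveB; [exact: dV|exact: dU].
- by rewrite in_itv/= lexx.
- by rewrite U0 V0 subrr.
Qed.

(** Solutions are functions on all of R whose values outside [0, T] are arbitrary, so the one picked
    by [texp] can be identified with U only on [0, T]. *)
Lemma texpP T G U : is_unique_ivp_solution T G U ->
  is_unique_ivp_solution T G (texp T G) /\
  {in `[0, T], forall t, texp T G t = U t}.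
Proof.
move=> uU; have uE : is_unique_ivp_solution T G (texp T G).
  exact: (@xgetI _ _ _ U uU).
by split => // t t0T; apply: uU.2 => //; exact: uE.1.
Qed.

(** Let P be the cokernel matrix of U t. Then x -> U x P solves the same equation and vanishes at t,
    hence also at 0, where its value is P. So P = 0 and U t has full rank. *)
Lemma ivp_unitmx T G U t : mx_integrable_on T G -> is_ivp_solution T G U ->
  t \in `[0, T] -> U t \in unitmx.
Proof.
move=> iG [cU U0 [S dU]] t0T.
have T0 : 0 <= T by move: t0T; rewrite in_itv/= => /andP[/le_trans]; exact.
rewrite -row_full_unit -cokermx_eq0; apply/eqP.
have := @mx_ode_zero _ _ t T G (fun x => U x *m cokermx (U t)) S.
move=> /(_ (mx_continuousM cU (mx_continuous_cst _ _)) iG).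
have dY x : x \in `]0, T[ -> x \notin S ->
    mx_is_derive x (fun y => U y *m cokermx (U t))
      (G x *m (U x *m cokermx (U t))).
  move=> x0T xS; rewrite mulmxA -[X in mx_is_derive _ _ X]addr0.
  rewrite -[X in _ + X](mulmx0 _ (U x)).
  by apply: mx_is_deriveM; [exact: dU|exact: mx_is_derive_cst].
move=> /(_ dY t0T (mulmx_coker _) 0); rewrite U0 mul1mx; apply.
by rewrite in_itv/= lexx.
Qed.

(** The size n is independent of N so that the minors in the adjugate are covered too. *)
Lemma ccont_det (n : nat) T (A : R -> 'M[R[i]]_n) :
  (forall k l, ccont T (fun x => A x k l)) -> ccont T (fun x => \det (A x)).
Proof.
move=> cA; apply: ccont_sum => s _; apply: ccontM; first exact: ccont_cst.
by apply: ccont_prod => k _.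
Qed.

Lemma cderivable_det (n : nat) t (A : R -> 'M[R[i]]_n) :
  (forall k l, cderivable t (fun x => A x k l)) ->
  cderivable t (fun x => \det (A x)).
Proof.
move=> dA; apply: cderivable_sum => s _; apply: cderivableM.
  exact: cderivable_cst.
by apply: cderivable_prod => k _.
Qed.

(** By Cramer's rule the entries of the inverse are cofactors divided by a determinant that does not
    vanish on [0, T]. *)
Lemma ivp_continuous_invmx T G U : mx_integrable_on T G ->
  is_ivp_solution T G U -> mx_continuous_on T (fun x => invmx (U x)).
Proof.
move=> iG solU; have [cU _ _] := solU.
have unitU x : x \in `[0, T] -> U x \in unitmx by exact: ivp_unitmx solU.
have cadj k l : ccont T (fun x => \adj (U x) k l).
  apply: (@ccont_ext _ _ (fun x => cofactor (U x) l k)) => [x _|].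
    by rewrite mxE.
  apply: ccontM; first exact: ccont_cst.
  apply: ccont_det => i j.
  apply: (@ccont_ext _ _ (fun x => U x (lift l i) (lift k j))) => [x _|].
    by rewrite !mxE.
  exact: cU.
move=> k l; apply: (@ccont_ext _ _ (fun x => (\det (U x))^-1 * \adj (U x) k l)).
  by move=> x x0T; rewrite /invmx unitU// [in RHS]mxE.
apply: ccontM => //; apply: ccontV; last exact: ccont_det.
by move=> x /unitU; rewrite unitmxE unitfE.
Qed.

(** Cramer's rule only shows that the inverse W has some derivative D. Differentiating W U = 1 gives
    D U + W G U = 0, and cancelling U on the right yields D = - W G. *)
Lemma ivp_is_derive_invmx T G U : mx_integrable_on T G ->
  is_ivp_solution T G U ->
  exists S : seq R, forall t, t \in `]0, T[ -> t \notin S ->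
    mx_is_derive t (fun x => invmx (U x)) (- (invmx (U t) *m G t)).
Proof.
move=> iG solU; have [cU _ [S dU]] := solU; exists S => t t0T tS.
have unitU x : x \in `]0, T[ -> U x \in unitmx.
  move=> x0T; apply: (ivp_unitmx iG solU).
  by move: x0T; rewrite !in_itv/= => /andP[/ltW -> /ltW].
have near_t : \forall x \near t, x \in `]0, T[ by exact: near_in_itvoo.
have dU' k l : cderivable t (fun x => U x k l).
  by exists ((G t *m U t) k l); exact: dU.
have dadj k l : cderivable t (fun x => \adj (U x) k l).
  under eq_fun do rewrite mxE.
  apply: cderivableM; first exact: cderivable_cst.
  apply: cderivable_det => i j.
  by under eq_fun do rewrite !mxE; exact: dU'.
(* [invmx] branches on invertibility; this plain formula agrees with it near t. *)
pose W x := (\det (U x))^-1 *: \adj (U x).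
have WE x : x \in `]0, T[ -> W x = invmx (U x).
  by move=> x0T; rewrite /invmx unitU.
have /choice[D0 D0P] : forall kl : 'I_N * 'I_N, exists d,
    is_cderive t (fun x => W x kl.1 kl.2) d.
  move=> [k l] /=.
  have -> : (fun x => W x k l) = (fun x => (\det (U x))^-1 * \adj (U x) k l).
    by apply/funext => x; rewrite [in LHS]mxE.
  apply: cderivableM => //; apply: cderivableV; last exact: cderivable_det.
  by have := unitU t t0T; rewrite unitmxE unitfE.
pose D := \matrix_(k, l) D0 (k, l).
have dW : mx_is_derive t W D.
  by move=> k l; rewrite mxE; exact: D0P (k, l).
have DE : D *m U t + W t *m (G t *m U t) = 0.
  apply: mx_is_derive_near_unique (mx_is_deriveM dW (dU t t0T tS))
    (mx_is_derive_cst t 1%:M).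
  by apply: filterS near_t => x x0T; rewrite WE// mulVmx// unitU.
have {DE} DE : D = - (W t *m G t).
  have := DE; rewrite mulmxA -mulmxDl.
  move=> /(congr1 (mulmxr (invmx (U t)))).
  by rewrite /= mulmxK ?unitU// mul0mx => /eqP; rewrite addr_eq0 => /eqP.
rewrite -WE// -DE => k l; have [dr di] := dW k l; split.
  apply: near_eq_is_derive dr.
  by apply: filterS near_t => x x0T; rewrite WE.
apply: near_eq_is_derive di.
by apply: filterS near_t => x x0T; rewrite WE.
Qed.

End ivp.

(** * Blocks of the time-ordered exponential *)

Section blocks.
Context {R : realType} {n m : nat}.
Context {T : R} {B : 'I_m -> 'I_m -> R -> 'M[R[i]]_n}.
Context (T_ge0 : 0 <= T).
Context (B_int : forall i j : 'I_m, (i <= j)%N -> mx_integrable_on T (B i j)).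
Context (B_ivp : exists X : R -> 'M[R[i]]_(\sum_(i < m) n),
  is_unique_ivp_solution T (upper_block B) X).

Local Notation C := (texp_block T B).
Local Notation U s := (texp T (B s s)).

Lemma texp_block_entry i j t k l :
  C i j t k l = texp T (upper_block B) t (tagnat.Rank i k) (tagnat.Rank j l).
Proof. by rewrite mxE. Qed.

Let texp_sol : is_ivp_solution T (upper_block B) (texp T (upper_block B)).
Proof. by have [X uX] := B_ivp; have [[]] := texpP uX. Qed.

Lemma texp_block_continuous i j : mx_continuous_on T (C i j).
Proof.
have [cX _ _] := texp_sol => k l.
apply: (ccont_ext _ (cX (tagnat.Rank i k) (tagnat.Rank j l))) => x _.
by rewrite texp_block_entry.
Qed.

Lemma texp_block0 i j : C i j 0 = if i == j then 1%:M else 0.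
Proof.
have [_ X0 _] := texp_sol; apply/matrixP => k l.
rewrite texp_block_entry X0 !mxE -val_eqE tagnat.eq_Rank.
by case: eqVneq => _ /=; rewrite mxE// val_eqE.
Qed.

(** Block (i, j) of X' = G X, where the zero blocks of G remove the terms with l < i. A single
    exceptional set serves all blocks. *)
Lemma texp_block_is_derive : exists S : seq R, forall t, t \in `]0, T[ ->
  t \notin S -> forall i j,
  mx_is_derive t (C i j) (\sum_(l < m | (i <= l)%N) B i l t *m C l j t).
Proof.
have [_ _ [S dX]] := texp_sol; exists S => t t0T tS i j.
have XE : texp T (upper_block B) t = \mxblock_(i, j) C i j t.
  by rewrite [LHS](esym (submxblockK _)).
have dC : \sum_(l < m | (i <= l)%N) B i l t *m C l j t =
    submxblock (upper_block B t *m texp T (upper_block B) t) i j.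
  rewrite XE mul_mxblock mxblockK big_mkcond; apply: eq_bigr => l _.
  by case: ifP => // _; rewrite mul0mx.
rewrite dC => k l; rewrite mxE.
under eq_fun do rewrite texp_block_entry.
under [X in _ /\ is_derive _ _ X _]eq_fun do rewrite texp_block_entry.
exact: dX.
Qed.

(** Induction on m - i, that is, from the last block row upwards: the blocks C_lj with l > i are
    already zero, which leaves C_ij' = B_ii C_ij with initial value 0. *)
Lemma texp_block_lower (i j : 'I_m) t :
  (j < i)%N -> t \in `[0, T] -> C i j t = 0.
Proof.
have [S dC] := texp_block_is_derive.
have [d] := ubnP (m - i); elim: d i t => // d IH i t; rewrite ltnS => mid ji.
apply: (@mx_ode_zero _ _ 0 T (B i i) (C i j) S).
- exact: texp_block_continuous.
- exact: B_int.
- move=> x x0T xS; have := dC x x0T xS i j.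
  rewrite (bigD1 i)//= big1 ?addr0// => l /andP[il li].
  rewrite IH ?mulmx0//.
  + rewrite (leq_trans _ mid)// ltn_sub2l//.
    by rewrite ltn_neqAle il andbT eq_sym.
  + exact: leq_trans il.
  + by move: x0T; rewrite !in_itv/= => /andP[/ltW -> /ltW].
- by rewrite in_itv/= lexx.
- by rewrite texp_block0 -val_eqE gtn_eqF.
Qed.

Lemma texp_block_diag_sol s : is_ivp_solution T (B s s) (C s s).
Proof.
split; first exact: texp_block_continuous.
  by rewrite texp_block0 eqxx.
have [S dC] := texp_block_is_derive; exists S => t t0T tS.
have := dC t t0T tS s s.
rewrite (bigD1 s)//= big1 ?addr0// => l /andP[sl ls].
rewrite texp_block_lower ?mulmx0//.
  by rewrite ltn_neqAle sl andbT eq_sym.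
by move: t0T; rewrite !in_itv/= => /andP[/ltW -> /ltW].
Qed.

(** Integrability of [B s s] makes C_ss its unique solution on [0, T], so the time-ordered
    exponential of the diagonal block is a genuine solution and not the default value. *)
Lemma texp_diagP s :
  is_ivp_solution T (B s s) (U s) /\ {in `[0, T], C s s =1 U s}.
Proof.
have /texpP[[solU _] UE] :=
  ivp_solution_unique (B_int (leqnn s)) (texp_block_diag_sol s).
by split => // t /UE ->.
Qed.

(** The factor in front of C_lk in the variation of constants formula. *)
Definition duhamel_kernel (s l : 'I_m) (u : R) := invmx (U s u) *m B s l u.

Lemma texp_diag_unitmx s t : t \in `[0, T] -> U s t \in unitmx.
Proof.
by apply: ivp_unitmx; [exact: B_int (leqnn s)|exact: (texp_diagP s).1].
Qed.

Lemma texp_diag_continuous s : mx_continuous_on T (U s).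
Proof. by have [[]] := texp_diagP s. Qed.

Lemma duhamel_kernel_integrable (s l : 'I_m) : (s <= l)%N ->
  mx_integrable_on T (duhamel_kernel s l).
Proof.
move=> sl; apply: mx_integrableMl; last exact: B_int.
by apply: ivp_continuous_invmx (texp_diagP s).1; exact: B_int.
Qed.

(** Variation of constants: U_s^-1 C_sk starts at 0 because s < k, and it is recovered by
    integrating its derivative. *)
Lemma texp_block_duhamel (s k : 'I_m) (t : R) : (s < k)%N -> t \in `[0, T] ->
  C s k t = \sum_(l < m | (s < l <= k)%N)
    U s t *m mx_int (fun u => duhamel_kernel s l u *m C l k u) t.
Proof.
move=> sk t0T; have solU := (texp_diagP s).1.
have [S1 dC] := texp_block_is_derive.
have [S2 dW] := ivp_is_derive_invmx (B_int (leqnn s)) solU.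
have [t0 tT] : 0 <= t /\ t <= T by apply/andP; move: t0T; rewrite in_itv.
have iKC (l : 'I_m) : (s < l <= k)%N ->
    mx_integrable_on t (fun u => duhamel_kernel s l u *m C l k u).
  move=> /andP[sl _]; apply: (mx_integrableS tT).
  apply: mx_integrableMr; first exact: texp_block_continuous.
  exact: duhamel_kernel_integrable (ltnW sl).
rewrite -mulmx_sumr -mx_int_sum//.
have := @mx_int_derive _ _ t (fun x => invmx (U s x) *m C s k x)
  (fun x => \sum_(l < m | (s < l <= k)%N) duhamel_kernel s l x *m C l k x)
  (S1 ++ S2) t0.
rewrite texp_block0 -val_eqE (ltn_eqF sk) mulmx0 subr0 => ->.
- by rewrite mulKVmx// texp_diag_unitmx.
- apply: (mx_continuousS tT); apply: mx_continuousM.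
    by apply: ivp_continuous_invmx solU; exact: B_int.
  exact: texp_block_continuous.
- exact: mx_integrable_sum.
move=> x x0t; rewrite mem_cat negb_or => /andP[xS1 xS2].
have x0T : x \in `]0, T[.
  by move: x0t; rewrite !in_itv/= => /andP[-> /lt_le_trans ->].
have x0T' : x \in `[0, T].
  by move: x0T; rewrite !in_itv/= => /andP[/ltW -> /ltW].
have := mx_is_deriveM (dW x x0T xS2) (dC x x0T xS1 s k).
(* The term l = s cancels the derivative of U_s^-1, and the terms with l > k contain blocks below
   the diagonal. *)
suff -> : - (invmx (U s x) *m B s s x) *m C s k x +
    invmx (U s x) *m (\sum_(l < m | (s <= l)%N) B s l x *m C l k x) =
  \sum_(l < m | (s < l <= k)%N) duhamel_kernel s l x *m C l k x by [].
rewrite (bigD1 s)//= mulmxDr !mulmxA mulNmx addrA addNr add0r.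
rewrite mulmx_sumr [LHS](bigID (fun l : 'I_m => (l <= k)%N))/=.
rewrite [X in _ + X]big1 ?addr0 => [|l /andP[_]]; last first.
  by rewrite -ltnNge => kl; rewrite texp_block_lower// mulmx0 mulmx0.
apply: eq_big => [l|l _]; last by rewrite mulmxA.
by congr (_ && _); rewrite ltn_neqAle andbC eq_sym.
Qed.

End blocks.

(** * Unfolding the recursion into sums over paths *)

Section iterated_integrals.
Context {R : realType} {n m : nat}.
Context {T : R} {B : 'I_m -> 'I_m -> R -> 'M[R[i]]_n}.
Context (T_ge0 : 0 <= T).
Context (B_int : forall i j : 'I_m, (i <= j)%N -> mx_integrable_on T (B i j)).
Context (B_ivp : exists X : R -> 'M[R[i]]_(\sum_(i < m) n),
  is_unique_ivp_solution T (upper_block B) X).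

Local Notation C := (texp_block T B).
Local Notation U s := (texp T (B s s)).
Local Notation K := (duhamel_kernel (T := T) (B := B)).
Local Notation lto := (fun a b : 'I_m => (a < b)%N).
Local Notation interaction := (fun (i j : 'I_m) (u : R) =>
  invmx (U i u) *m B i j u *m U j u).

Let interaction_integrable (s l : 'I_m) : (s <= l)%N ->
  mx_integrable_on T (interaction s l).
Proof.
move=> sl; apply: mx_integrableMr.
  exact: (texp_diag_continuous T_ge0 B_int B_ivp).
exact: (duhamel_kernel_integrable T_ge0 B_int B_ivp).
Qed.

Let in_itvS (t x : R) : t \in `[0, T] -> x \in `[0, t] -> x \in `[0, T].
Proof. by rewrite !in_itv/= => /andP[_ tT] /andP[-> /le_trans ->]. Qed.

(** [iter_int] accumulates the earlier factors in P and multiplies them in at the innermost level;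
    pulling P out turns it into an honest nested integral. Both claims go through one induction:
    pulling P out requires an integrable integrand, which comes from continuity of the inner
    integral. *)
Lemma iter_int_pairmap (s : 'I_m) (q : seq 'I_m) : path lto s q ->
  mx_continuous_on T (iter_int (pairmap interaction s q) 1%:M) /\
  forall P t, t \in `[0, T] -> iter_int (pairmap interaction s q) P t =
    P *m iter_int (pairmap interaction s q) 1%:M t.
Proof.
elim: q s => [|l q IH] s /=.
  by split=> [|P t _]; [exact: mx_continuous_cst|rewrite mulmx1].
move=> /andP[sl /IH[cI PI]].
pose H u := interaction s l u *m iter_int (pairmap interaction l q) 1%:M u.
have iH : mx_integrable_on T H.
  by apply: mx_integrableMr => //; exact: interaction_integrable (ltnW sl).
have HE P t : t \in `[0, T] ->
    mx_int (fun u => iter_int (pairmap interaction l q)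
      (P *m interaction s l u) u) t = P *m mx_int H t.
  move=> t0T; have tT : t <= T by move: t0T; rewrite in_itv/= => /andP[].
  rewrite -mx_intMl; last exact: mx_integrableS iH.
  by apply: eq_mx_int => u /(in_itvS t0T) u0T; rewrite PI// -[LHS]mulmxA.
split=> [|P t t0T]; last by rewrite (HE _ _ t0T) (HE 1%:M _ t0T) mul1mx.
apply: (mx_continuous_ext _ (mx_continuous_int T_ge0 iH)) => t t0T.
by rewrite HE// mul1mx.
Qed.

Lemma IntB_continuous (s : 'I_m) (q : seq 'I_m) : path lto s q ->
  mx_continuous_on T (IntB T B s q).
Proof.
move=> /iter_int_pairmap[cI _]; apply: mx_continuousM => //.
exact: (texp_diag_continuous T_ge0 B_int B_ivp).
Qed.

(** With this one-index convention, the direct transition from s to k is an instance of the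
    recursion [IntB_cons]. *)
Lemma IntB_nil (s : 'I_m) (t : R) : IntB T B s [::] t = U s t.
Proof. by rewrite /IntB mulmx1. Qed.

(** The last factor U_l of the first interaction becomes the leading factor of the shorter integral,
    leaving the kernel U_s^-1 B_sl. *)
Lemma IntB_cons (s l : 'I_m) (q : seq 'I_m) (t : R) :
  path lto s (l :: q) -> t \in `[0, T] ->
  IntB T B s (l :: q) t =
    U s t *m mx_int (fun u => K s l u *m IntB T B l q u) t.
Proof.
move=> /= /andP[sl /iter_int_pairmap[_ PI]] t0T; congr (_ *m _).
apply: eq_mx_int => u /(in_itvS t0T) u0T.
by apply: (etrans (PI _ _ u0T)); rewrite mul1mx /IntB /duhamel_kernel !mulmxA.
Qed.

(** Here r counts the intermediate indices of the increasing paths from s to k. *)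
Definition IntB_sum (r : nat) (s k : 'I_m) (t : R) :=
  \sum_(p : r.-tuple 'I_m | path lto s (rcons p k)) IntB T B s (rcons p k) t.

Lemma IntB_sum_continuous (r : nat) (s k : 'I_m) :
  mx_continuous_on T (IntB_sum r s k).
Proof.
move=> a b; apply: (@ccont_ext _ _ (fun t => \sum_(p : r.-tuple 'I_m |
    path lto s (rcons p k)) IntB T B s (rcons p k) t a b)) => [t _|].
  by rewrite summxE.
by apply: ccont_sum => p sp; exact: IntB_continuous.
Qed.

Lemma IntB_sum0 (s k : 'I_m) (t : R) : (s < k)%N ->
  IntB_sum 0 s k t = IntB T B s [:: k] t.
Proof.
move=> sk; rewrite /IntB_sum (big_pred1 [tuple])// => p.
by rewrite tuple0 /= sk andbT eqxx.
Qed.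

Lemma big_tuple_cons (V : nmodType) (I : finType) (r : nat)
    (P : pred (seq I)) (F : seq I -> V) :
  \sum_(p : r.+1.-tuple I | P p) F p =
  \sum_(l : I) \sum_(p : r.-tuple I | P (l :: p)) F (l :: p).
Proof.
rewrite pair_big_dep/=.
rewrite (reindex (fun lp : I * r.-tuple I => [tuple of lp.1 :: lp.2]))//=.
exists (fun p : r.+1.-tuple I => (thead p, [tuple of behead p])).
  by move=> [l p] _; congr (_, _); apply: val_inj.
by move=> p _; rewrite [RHS]tuple_eta.
Qed.

Lemma path_rcons_lt (s k : 'I_m) (p : seq 'I_m) :
  path lto s (rcons p k) -> (s < k)%N.
Proof.
move=> /order_path_min; rewrite all_rcons => sp.
suff /andP[] : lto s k && all (lto s) p by [].
by apply: sp => a b c; exact: ltn_trans.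
Qed.

(** Paths are grouped by their first intermediate index l; no increasing path exists unless s < l <
    k. *)
Lemma IntB_sumS (r : nat) (s k : 'I_m) (t : R) : t \in `[0, T] ->
  IntB_sum r.+1 s k t =
  \sum_(l < m | (s < l < k)%N)
    U s t *m mx_int (fun u => K s l u *m IntB_sum r l k u) t.
Proof.
move=> t0T; have tT : t <= T by move: t0T; rewrite in_itv/= => /andP[].
rewrite /IntB_sum (big_tuple_cons r (fun p => path lto s (rcons p k))
  (fun p => IntB T B s (rcons p k) t)) [RHS]big_mkcond.
apply: eq_bigr => l _; case: ifPn => [/andP[sl lk]|slk]; last first.
  rewrite big1// => p /= /andP[sl /path_rcons_lt lk].
  by rewrite sl lk in slk.
under [in RHS]eq_mx_int => u _ do rewrite mulmx_sumr.
rewrite mx_int_sum; last first.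
  move=> p lp; apply: (mx_integrableS tT); apply: mx_integrableMr.
    exact: IntB_continuous.
  exact: (duhamel_kernel_integrable T_ge0 B_int B_ivp (ltnW sl)).
rewrite mulmx_sumr; apply: eq_big => [p|p /= slp]; first by rewrite /= sl.
by rewrite -IntB_cons.
Qed.

(** Induction on a bound d for k - s, unfolding the recursion once. The term l = k is the path
    without intermediate index; for s < l < k the induction hypothesis expands C_lk, and prepending
    l turns r intermediate indices into r + 1. *)
Lemma texp_block_IntB (d : nat) (s k : 'I_m) (t : R) :
  (s < k)%N -> (k - s <= d)%N -> t \in `[0, T] ->
  C s k t = \sum_(r < d) IntB_sum r s k t.
Proof.
elim: d s t => [|d IH] s t sk ksd t0T.
  by move: ksd; rewrite leqn0 subn_eq0 leqNgt sk.
have tT : t <= T by move: t0T; rewrite in_itv/= => /andP[].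
rewrite (texp_block_duhamel T_ge0 B_int B_ivp)// (bigD1 k) ?sk ?leqnn//=.
rewrite [RHS]big_ord_recl; congr (_ + _).
  apply: (etrans _ (esym (IntB_sum0 t sk))).
  have sk' : path lto s [:: k] by rewrite /= sk.
  rewrite (IntB_cons sk' t0T); apply: (congr1 (mulmx (U s t))).
  apply: eq_mx_int => u /(in_itvS t0T) u0T.
  by rewrite IntB_nil ((texp_diagP T_ge0 B_int B_ivp k).2 u u0T).
transitivity (\sum_(r < d) \sum_(l < m | (s < l < k)%N)
    U s t *m mx_int (fun u => K s l u *m IntB_sum r l k u) t); last first.
  by apply: eq_bigr => r _; rewrite -(IntB_sumS _ _ _ t0T).
rewrite exchange_big/=; apply: eq_big => [l|l /andP[/andP[sl lk] lnk]].
  by rewrite -andbA; congr (_ && _); rewrite [RHS]ltn_neqAle andbC.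
have {lnk} lk' : (l < k)%N by rewrite ltn_neqAle lnk.
rewrite -mulmx_sumr -mx_int_sum; last first.
  move=> r _; apply: (mx_integrableS tT); apply: mx_integrableMr.
    exact: IntB_sum_continuous.
  exact: (duhamel_kernel_integrable T_ge0 B_int B_ivp (ltnW sl)).
apply: (congr1 (mulmx (U s t))); apply: eq_mx_int => u /(in_itvS t0T) u0T.
rewrite IH// ?mulmx_sumr//.
by rewrite -ltnS (leq_trans _ ksd)// ltn_sub2l.
Qed.

End iterated_integrals.

(** * The explicit and recursive formulas for the blocks *)

Unset Implicit Arguments.

Theorem theorem1 (R : realType) (T : R) (n m : nat)
    (B : 'I_m -> 'I_m -> R -> 'M[R[i]]_n)
    (T_gt0 : 0 < T) (n_ge1 : (1 <= n)%N) (m_ge1 : (1 <= m)%N)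
    (B_int : forall i j : 'I_m, (i <= j)%N -> mx_integrable_on T (B i j))
    (B_ivp : exists X : R -> 'M[R[i]]_(\sum_(i < m) n),
       is_unique_ivp_solution T (upper_block B) X) :
  let C := texp_block T B in
  let U := fun i : 'I_m => texp T (B i i) in
  [/\ forall (i j : 'I_m) (t : R), (j < i)%N -> t \in `[0, T] -> C i j t = 0,
      forall (s : 'I_m) (t : R), t \in `[0, T] -> C s s t = U s t
    & forall (s k : 'I_m) (j : nat) (t : R),
        (1 <= j)%N -> nat_of_ord k = (s + j)%N -> t \in `[0, T] ->
        C s k t = IntB T B s [:: k] t
          + \sum_(1 <= r < j)
              \sum_(p : r.-tuple 'I_m |
                    path (fun a b : 'I_m => (a < b)%N) s (rcons p k))
                IntB T B s (rcons p k) t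
        /\
        C s k t = \sum_(l < m | (s < l <= k)%N)
          U s t *m mx_int (fun u : R => invmx (U s u) *m B s l u *m C l k u) t].
Proof.
move=> C U; have T_ge0 : 0 <= T by exact: ltW.
split.
- by move=> i j t ji t0T; exact: (texp_block_lower T_ge0 B_int B_ivp ji t0T).
- by move=> s t t0T; exact: ((texp_diagP T_ge0 B_int B_ivp s).2 t t0T).
move=> s k j t j_gt0 kE t0T.
have sk : (s < k)%N by rewrite kE -addn1 leq_add2l.
split; last exact: (texp_block_duhamel T_ge0 B_int B_ivp sk t0T).
have ksj : (k - s <= j)%N by rewrite kE addKn.
apply: (etrans (texp_block_IntB T_ge0 B_int B_ivp sk ksj t0T)).
(* The term r = 0 is split off as the direct integral from s to k, so the remaining sum starts at
   1. *)
rewrite -(big_mkord xpredT (fun r => IntB_sum r s k t)) (big_ltn j_gt0).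
by rewrite (IntB_sum0 t sk).
Qed.
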